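(* Consider any execution of the MonadBFT protocol (specified in the context) with $n=3f+1$ validators of which at most $f$ are Byzantine. Suppose a leader proposes a block $B$ as part of a fresh proposal $p$ and at least $f+1$ correct validators vote for $p$. Then, unless that leader equivocates (in view $p.view$), any block $B'$ committed by a correct validator satisfies: $B$ extends $B'$ or $B'$ extends $B$.
   Context: MODEL. There are $n=3f+1$ validators; at most $f$ are Byzantine (arbitrary behaviour), the others are correct and follow the protocol. Channels are point-to-point, authenticated and reliable. The network is partially synchronous: there are an unknown time GST and a known $\Delta>0$ such that a message sent at time $\tau$ between correct validators is delivered by $\max(\tau,\mathrm{GST})+\Delta$. ''Broadcast'' means send to all validators (including oneself). Local computation takes no time. Signatures and aggregate signatures are unforgeable; the hash function $H$ is treated as collision-free. An aggregate of $2f+1$ signatures means signatures of $2f+1$ distinct validators. Views are positive integers; each view $v$ has a leader, assigned round-robin. A validator stores all proposals it receives; on obtaining a QC it is assumed also to obtain the proposal the QC points to (and ancestors as needed). $\bot$ denotes an absent field. A correct leader issues at most one proposal per view. DATA. Block $B=\langle block\_view, payload, payload\_hash, qc, block\_hash\rangle$ with $block\_hash=H(block\_view,payload\_hash,qc)$; its header is $B$ without $payload$. Vote $\langle view, block\_hash, proposal\_id,\sigma\rangle$, valid if $proposal\_id=H(block\_hash,view)$ and $\sigma$ is a valid signature on the other fields. QC $\langle view, block\_hash, proposal\_id,\Sigma\rangle$, valid if $proposal\_id=H(block\_hash,view)$ and $\Sigma$ aggregates $2f+1$ signatures on the other fields; it points to any proposal with the same $proposal\_id$. Proposal $p=\langle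 view, proposal\_id, block,\sigma,tc,nec\rangle$ with $proposal\_id=H(block.block\_hash,view)$, $\sigma$ the leader's signature on $proposal\_id$ ($tc,nec$ possibly $\bot$). The tip of $p$ is $p$ with its block replaced by the block header. Timeout message $M=\langle view, tip, tip\_vote, qc, last\_cer,\sigma\rangle$. Timeout certificate (TC) $\langle view, tips\_views, high\_tip, qcs\_views, high\_qc,\Sigma\rangle$, where $tips\_views,qcs\_views$ give for each of $2f+1$ contributing validators the view of the reported tip ($\bot$, counted as $0$ in maxima, if it reported a QC) and the view of the reported QC (of the QC in the tip's header if it reported a tip). No-endorsement certificate (NEC) $\langle view, high\_tip\_qc\_view,\Sigma\rangle$. There are a genesis block and a genesis tip and genesis QC of view $0$, valid without signatures; initially they are $local\_tip$ and $last\_qc$. VALIDITY. A header is valid if its $qc$ is valid and its $block\_hash$ is correct; a block is valid if additionally $payload\_hash=H(payload)$. fresh($p$): $p.block.qc.view=p.view-1$, or $p.nec\ne\bot$, or ($p.tc\neq\bot$ and $p.tc.high\_qc\ne\bot$). Valid fresh tip $T$: valid header, correct $proposal\_id$, $\sigma$ by the leader of $T.view$, $header.block\_view=T.view>header.qc.view$, and: if $T.view=header.qc.view+1$ then $T.tc=T.nec=\bot$; otherwise $T.tc\neq\bot$ is valid with $T.view=T.tc.view+1$, and either ($T.nec=\bot$, $T.tc.high\_qc\ne\bot$ and $header.qc=T.tc.high\_qc$) or ($T.nec$ is valid, $T.view=T.nec.view$ and $header.qc.view=T.nec.high\_tip\_qc\_view$). Valid proposal $p$: valid block, correct $proposal\_id$,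 $\sigma$ by the leader of $p.view$, $p.view\ge p.block.block\_view$, $p.view>p.block.qc.view$, and: if fresh($p$), the tip of $p$ is a valid fresh tip; otherwise (''reproposal'') $p.view>p.block.block\_view$, $p.tc\neq\bot$ is valid, $p.view=p.tc.view+1$, $p.tc.high\_tip\ne\bot$, and the header of $p.block$ equals $p.tc.high\_tip$'s header. (So a valid proposal is fresh iff $p.view=p.block.block\_view$.) Valid timeout message $M$: $last\_cer$ is a valid QC or TC with $last\_cer.view=M.view-1$; exactly one of $tip,qc$ is non-$\bot$; if $tip\neq\bot$: $tip\_vote$ is a valid vote with $tip\_vote.view=M.view$, $tip$ is a valid fresh tip with $tip.view\le M.view$, $\sigma$ signs $(M.view,tip.view,tip.header.qc.view)$; if $qc\ne\bot$: $qc$ is valid, $qc.view<M.view$, $\sigma$ signs $(M.view,\bot,qc.view)$. Valid TC $tc$: $\Sigma$ aggregates $2f+1$ timeout signatures certifying $view,tips\_views,qcs\_views$; and either ($high\_qc\ne\bot$ is valid, $high\_tip=\bot$, $high\_qc.view<tc.view$, $\max(tips\_views)\le high\_qc.view=\max(qcs\_views)$) or ($high\_qc=\bot$, $high\_tip$ is a valid fresh tip, $high\_tip.view\le tc.view$, $qcs\_views[i]<tips\_views[i]$ whenever $tips\_views[i]\ne\bot$, no $tips\_views[i]>high\_tip.view$, no $i$ with $tips\_views[i]=high\_tip.view$ and $qcs\_views[i]>high\_tip.header.qc.view$, and $high\_tip.view>\max(qcs\_views)$). Valid NEC: $high\_tip\_qc\_view<view-1$ and $\Sigma$ aggregates $2f+1$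 signatures on $(view,high\_tip\_qc\_view)$. LOCAL STATE of validator $i$: $cur\_view$, $local\_tip$, $highest\_voted\_view$, $last\_qc$, $last\_tc$, collected votes and timeouts, and a timer. At start every validator performs Enter(genesis QC), entering view $1$, and the leader of view 1 performs ProposeQC(genesis QC). PROCEDURES. Enter($c$) ($c$ a QC or TC): if $c.view\ge cur\_view$, set $cur\_view:=c.view+1$, restart the timer, and set $last\_qc:=c$ (QC) or $last\_tc:=c$ (TC). Commit($qc$): let $parent$ be the proposal $qc$ points to and $gp$ the proposal $parent.block.qc$ points to; if fresh($parent$), speculatively commit $parent.block$; if $qc.view=parent.block.qc.view+1$, commit $gp.block$ (and all its ancestors). ProposeQC($qc$): broadcast a proposal for $cur\_view$ with a new block $B$, $B.block\_view=cur\_view$, $B.qc=qc$, and $tc=nec=\bot$. ProposeTC($tc$): if $tc.high\_qc\neq\bot$, broadcast a proposal for $cur\_view$ with a new block with $qc=tc.high\_qc$, this $tc$, $nec=\bot$; else if the block of $tc.high\_tip$ is available, broadcast a proposal for $cur\_view$ containing that same block, this $tc$, $nec=\bot$; else run Recover($tc$): if it returns a proposal, repropose its block as before; if it returns an NEC, broadcast a proposal with a new block with $qc=tc.high\_tip.header.qc$, this $tc$, and this $nec$. Recover($tc$): broadcast $\langle\mathsf{NERequest},tc\rangle$, send $\langle\mathsf{ProposalRequest},tc\rangle$ to $\kappa$ validators and, every $\Theta_{interval}$ time, to $\kappa$ further ones; return the first received proposal with $proposal\_id=tc.high\_tip.proposal\_id$, or an NEC with view $tc.view+1$ and $high\_tip\_qc\_view=tc.high\_tip.header.qc.view$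 once $2f+1$ validators sent valid NE signatures on this pair; abort if Recover is called for a higher view. BroadcastQC($qc$): broadcast $qc$ if not yet done. HANDLERS (messages of a view smaller than indicated, or invalid, are ignored). (1) On a valid proposal $p$ from the leader of $p.view\ge cur\_view$: Enter($p.tc$) if $p.tc\ne\bot$, else Enter($p.block.qc$); if $p.block.qc.view=p.view-1$, then BroadcastQC($p.block.qc$) if $i$ is the leader of view $p.block.qc.view$, and send $p.block.qc$ to that leader; Commit($p.block.qc$); if $p.view>highest\_voted\_view$: set $local\_tip$ to the tip of $p$ if fresh($p$) and to $p.tc.high\_tip$ otherwise, send a vote for ($cur\_view$, block hash of $local\_tip$) to the leaders of views $cur\_view$ and $cur\_view+1$, and set $highest\_voted\_view:=cur\_view$. (2) On a valid vote with view $v\ge cur\_view$, if $i$ leads $v$ or $v+1$: once $2f+1$ votes with the same $proposal\_id$ are collected, form the QC $qc$; Enter($qc$); Commit($qc$); BroadcastQC($qc$) if $i$ leads $v$, else ProposeQC($qc$). (3) On a valid QC $qc$ from $j$ with $qc.view\ge cur\_view$: if $j$ leads $qc.view$: Enter($qc$), Commit($qc$), send $qc$ to the leader of $qc.view+1$; if $i$ leads $qc.view$: BroadcastQC($qc$); if $i$ leads $qc.view+1$: Enter($qc$), Commit($qc$), ProposeQC($qc$). (4) On timing out in $cur\_view=v$ (at most once per view; when the timer reaches $\Theta_{view}$ or when triggered in (5)): $highest\_voted\_view:=v$; broadcast a timeout message for view $v$ with $last\_cer=last\_qc$ if $last\_qc.view=v-1$ and $last\_cer=last\_tc$ otherwise;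 if $local\_tip.view\le last\_qc.view$ it has $qc=last\_qc$, $tip=tip\_vote=\bot$; otherwise $tip=local\_tip$, $tip\_vote$ a vote for ($v$, block hash of $local\_tip$), $qc=\bot$. (5) On a valid timeout message $M$ with $M.view\ge cur\_view$: let $c=M.last\_cer$; if $c$ is a TC and $i$ has broadcast neither a timeout message nor a TC for $c.view$, broadcast $c$; Enter($c$); if $i$ leads $c.view+1$ and has issued no proposal for it, ProposeQC($c$) or ProposeTC($c$) according to the type of $c$; if $c$ is a QC: BroadcastQC($c$) if $i$ leads $c.view$, send $c$ to the leaders of $c.view$ and $c.view+1$, Commit($c$). Then: if $M.tip\neq\bot$, record $M.tip\_vote$; if $2f+1$ tip votes with the same $proposal\_id$ are recorded, form the QC $qc$, Enter($qc$), Commit($qc$), ProposeQC($qc$) if $i$ leads $qc.view+1$, and stop. Otherwise record $M$; when $f+1$ timeout messages for $M.view$ are recorded, trigger the timeout of view $M.view$ if not yet triggered; when $2f+1$ are recorded, form a TC $tc$ (with $high\_tip$ the reported tip of highest view, ties broken by highest $header.qc.view$, if this view exceeds all reported QC views; otherwise with $high\_qc$ the highest reported QC), Enter($tc$), and ProposeTC($tc$) if $i$ leads $tc.view+1$. (6) On a valid TC $tc$ with $tc.view\ge cur\_view$: Enter($tc$); broadcast $tc$ if no TC and no timeout message was broadcast for $tc.view$; ProposeTC($tc$) if $i$ leads $tc.view+1$. (7) On $\langle\mathsf{ProposalRequest},tc\rangle$ or $\langle\mathsf{NERequest},tc\rangle$ from the leader of $tc.view+1\ge cur\_view$, with $tc$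 valid and $tc.high\_tip\neq\bot$: Enter($tc$); for a ProposalRequest, if $i$ has a proposal with $proposal\_id=tc.high\_tip.proposal\_id$, send it to that leader; for an NERequest, if $i$ has not voted for a proposal with that $proposal\_id$ and has sent no NE message in view $tc.view+1$, send that leader an NE signature on $(tc.view+1,tc.high\_tip.header.qc.view)$. TERMINOLOGY. Block $B_1$ is the parent of $B_2$ if some proposal $p$ has $p.block=B_1$ and $p.proposal\_id=B_2.qc.proposal\_id$. Block $B_2$ extends $B_1$ if $B_2=B_1$ or $B_2$ is a descendant of $B_1$ under the parent relation. Committing a block commits all its ancestors. A validator votes for $p$ if it sends (directly, or as $tip\_vote$ in a timeout message) a vote whose $proposal\_id$ equals $p.proposal\_id$. A proposal is fresh if it contains a new block ($p.view=p.block.block\_view$). A leader equivocates in a view if it issues more than one distinct proposal in that view. *)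

(* Defs.v *)
From HB Require Import structures.
From Stdlib Require List.
From Stdlib Require Import Relation_Operators.
From mathcomp Require Import all_boot all_order all_algebra.
From mathcomp Require Import reals.

Set Implicit Arguments.
Unset Strict Implicit.
Unset Printing Implicit Defensive.

(* Validators are the ordinals below n = 3f+1, numbered by their position in the
   leader rotation. *)

Section Data.
Context (f : nat) (Payload : Type) (Hash : eqType).

Definition validator := 'I_(3 * f).+1.
Definition quorum := (2 * f).+1.
Definition leader (v : nat) : validator := inZp v.

(* Signatures are symbolic: the pair (i, x) is the signature of i on x.  The
   constructors separate the kinds of signed content. *)
Inductive signed :=
| SVote of nat & Hash & Hash
| SProposal of Hash
| STimeout of nat & option nat & nat
| SNE of nat & nat.

Definition signed_code (x : signed) :
    (nat * Hash * Hash) + Hash + (nat * option nat * nat) + (nat * nat) :=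
  match x with
  | SVote v h p => inl (inl (inl (v, h, p)))
  | SProposal p => inl (inl (inr p))
  | STimeout v t q => inl (inr (v, t, q))
  | SNE v q => inr (v, q)
  end.
Definition signed_decode
    (y : (nat * Hash * Hash) + Hash + (nat * option nat * nat) + (nat * nat)) :=
  match y with
  | inl (inl (inl (v, h, p))) => SVote v h p
  | inl (inl (inr p)) => SProposal p
  | inl (inr (v, t, q)) => STimeout v t q
  | inr (v, q) => SNE v q
  end.
Lemma signed_codeK : cancel signed_code signed_decode. Proof. by case. Qed.
HB.instance Definition _ := Equality.copy signed (can_type signed_codeK).

Definition signature := (validator * signed)%type.

(* An aggregate signature is the list of the signatures it aggregates. *)
Definition aggregate_ok (content : validator -> signed) (Sig : seq signature) :=
  [&& uniq [seq s.1 | s <- Sig], size Sig == quorum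
    & all (fun s => s.2 == content s.1) Sig].

Record qc := QC { qc_view : nat; qc_block_hash : Hash; qc_id : Hash;
                  qc_sigma : seq signature }.
Definition qc_code (q : qc) :=
  (qc_view q, qc_block_hash q, qc_id q, qc_sigma q).
Definition qc_decode (y : nat * Hash * Hash * seq signature) :=
  let: (v, h, p, sg) := y in QC v h p sg.
Lemma qc_codeK : cancel qc_code qc_decode. Proof. by case. Qed.
HB.instance Definition _ := Equality.copy qc (can_type qc_codeK).

Record header := Header { block_view : nat; payload_hash : Hash;
                          header_qc : qc; block_hash : Hash }.
Definition header_code (h : header) :=
  (block_view h, payload_hash h, header_qc h, block_hash h).
Definition header_decode (y : nat * Hash * qc * Hash) :=
  let: (v, p, q, b) := y in Header v p q b.
Lemma header_codeK : cancel header_code header_decode. Proof. by case. Qed.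
HB.instance Definition _ := Equality.copy header (can_type header_codeK).

Record block := Block { block_header :> header; payload : Payload }.

Record vote := Vote { vote_view : nat; vote_block_hash : Hash; vote_id : Hash;
                      vote_sigma : signature }.
Definition vote_code (x : vote) :=
  (vote_view x, vote_block_hash x, vote_id x, vote_sigma x).
Definition vote_decode (y : nat * Hash * Hash * signature) :=
  let: (v, h, p, s) := y in Vote v h p s.
Lemma vote_codeK : cancel vote_code vote_decode. Proof. by case. Qed.
HB.instance Definition _ := Equality.copy vote (can_type vote_codeK).

Record nec := NEC { nec_view : nat; high_tip_qc_view : nat;
                    nec_sigma : seq signature }.

(* The fields of [tip] are: view, proposal_id, header, sigma, tc, nec; those of
   [tc] are: view, tips_views, qcs_views, high_tip, high_qc, Sigma.  The
   contributors of a TC are the signers in Sigma, and tips_views and qcs_views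
   are meaningful only at these. *)
Inductive tip :=
| Tip of nat & Hash & header & option signature & option tc & option nec
with tc :=
| TC of nat & {ffun validator -> option nat} & {ffun validator -> nat}
     & option tip & option qc & seq signature.

Definition tip_view (T : tip) := let: Tip v _ _ _ _ _ := T in v.
Definition tip_id (T : tip) := let: Tip _ p _ _ _ _ := T in p.
Definition tip_header (T : tip) := let: Tip _ _ h _ _ _ := T in h.
Definition tip_qc_view (T : tip) := qc_view (header_qc (tip_header T)).

Definition tc_view (c : tc) := let: TC v _ _ _ _ _ := c in v.
Definition high_tip (c : tc) := let: TC _ _ _ T _ _ := c in T.
Definition high_qc (c : tc) := let: TC _ _ _ _ q _ := c in q.

Record proposal := Proposal {
  prop_view : nat; prop_id : Hash; prop_block : block;
  prop_sigma : option signature; prop_tc : option tc; prop_nec : option nec }.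

Definition tip_of (p : proposal) :=
  Tip (prop_view p) (prop_id p) (prop_block p) (prop_sigma p) (prop_tc p)
      (prop_nec p).

Definition points_to (q : qc) (p : proposal) := prop_id p == qc_id q.

Inductive cert := CQC of qc | CTC of tc.
Definition cert_view (c : cert) :=
  match c with CQC q => qc_view q | CTC t => tc_view t end.

Record timeout_msg := TimeoutMsg {
  tm_view : nat; tm_tip : option tip; tm_tip_vote : option vote;
  tm_qc : option qc; tm_last_cer : option cert; tm_sigma : signature }.

Inductive msg :=
| MProposal of proposal
| MVote of vote
| MQC of qc
| MTimeout of timeout_msg
| MTC of tc
| MProposalRequest of tc
| MNERequest of tc
| MNE of nat & nat & signature.

(* The proposal_id of the vote sent with a message, if any. *)
Definition voted_id (m : msg) : option Hash :=
  match m with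
  | MVote x => Some (vote_id x)
  | MTimeout M => omap vote_id (tm_tip_vote M)
  | _ => None
  end.

Definition header_sigs (h : header) := qc_sigma (header_qc h).
Definition oapp_seq (A B : Type) (g : A -> seq B) (o : option A) : seq B :=
  if o is Some a then g a else [::].
Definition osig (s : option signature) := oapp_seq (fun x => [:: x]) s.

Fixpoint tip_sigs (T : tip) : seq signature :=
  let: Tip _ _ h s c n := T in
  header_sigs h ++ osig s ++ (if c is Some c' then tc_sigs c' else [::])
    ++ oapp_seq nec_sigma n
with tc_sigs (c : tc) : seq signature :=
  let: TC _ _ _ T q Sig := c in
  (if T is Some T' then tip_sigs T' else [::]) ++ oapp_seq qc_sigma q ++ Sig.

Fixpoint tip_qcs (T : tip) : seq qc :=
  let: Tip _ _ h _ c _ := T in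
  header_qc h :: (if c is Some c' then tc_qcs c' else [::])
with tc_qcs (c : tc) : seq qc :=
  let: TC _ _ _ T q _ := c in
  (if T is Some T' then tip_qcs T' else [::]) ++ oapp_seq (fun x => [:: x]) q.

Definition cert_sigs (c : cert) :=
  match c with CQC q => qc_sigma q | CTC t => tc_sigs t end.
Definition cert_qcs (c : cert) :=
  match c with CQC q => [:: q] | CTC t => tc_qcs t end.

Definition msg_sigs (m : msg) : seq signature :=
  match m with
  | MProposal p => tip_sigs (tip_of p)
  | MVote x => [:: vote_sigma x]
  | MQC q => qc_sigma q
  | MTimeout M =>
      oapp_seq tip_sigs (tm_tip M)
      ++ oapp_seq (fun x => [:: vote_sigma x]) (tm_tip_vote M)
      ++ oapp_seq qc_sigma (tm_qc M) ++ oapp_seq cert_sigs (tm_last_cer M)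
      ++ [:: tm_sigma M]
  | MTC c | MProposalRequest c | MNERequest c => tc_sigs c
  | MNE _ _ s => [:: s]
  end.

Definition msg_qcs (m : msg) : seq qc :=
  match m with
  | MProposal p => tip_qcs (tip_of p)
  | MQC q => [:: q]
  | MTimeout M =>
      oapp_seq tip_qcs (tm_tip M) ++ oapp_seq (fun x => [:: x]) (tm_qc M)
      ++ oapp_seq cert_qcs (tm_last_cer M)
  | MTC c | MProposalRequest c | MNERequest c => tc_qcs c
  | MVote _ | MNE _ _ _ => [::]
  end.

(* The strings that get hashed. *)
Inductive hash_input :=
| InGenesis
| InPayload of Payload
| InBlock of nat & Hash & qc
| InId of Hash & nat.

End Data.

Arguments MVote {f Payload Hash} _.
Arguments MQC {f Payload Hash} _.
Arguments MTimeout {f Payload Hash} _.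
Arguments MTC {f Payload Hash} _.
Arguments MProposalRequest {f Payload Hash} _.
Arguments MNERequest {f Payload Hash} _.
Arguments MNE {f Payload Hash} _ _ _.
Arguments SNE {Hash} _ _.
Arguments STimeout {Hash} _ _ _.
Arguments InGenesis {f Payload Hash}.
Arguments InPayload {f Payload Hash} _.
Arguments InBlock {f Payload Hash} _ _ _.
Arguments InId {f Payload Hash} _ _.

Section Validity.
Context (f : nat) (Payload : Type) (Hash : eqType).
Context (H : hash_input f Payload Hash -> Hash) (genesis_payload : Payload).

Notation qc := (qc f Hash).
Notation header := (header f Hash).
Notation block := (block f Payload Hash).
Notation proposal := (proposal f Payload Hash).
Notation tip := (tip f Hash).
Notation tc := (tc f Hash).
Notation nec := (nec f Hash).

Definition id_of (bh : Hash) (v : nat) := H (InId bh v).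

(* The genesis QC certifies the genesis block, whose own qc field is again the
   genesis QC; its hash is that of a dedicated string, as hashing its fields
   would be circular. *)
Definition genesis_hash := H InGenesis.
Definition genesis_qc : qc := QC 0 genesis_hash (id_of genesis_hash 0) [::].
Definition genesis_header : header :=
  Header 0 (H (InPayload genesis_payload)) genesis_qc genesis_hash.
Definition genesis_block : block := Block genesis_header genesis_payload.
Definition genesis_proposal : proposal :=
  Proposal 0 (id_of genesis_hash 0) genesis_block None None None.
Definition genesis_tip : tip := tip_of genesis_proposal.

Definition correct_hash (h : header) :=
  (h == genesis_header)
  || (block_hash h == H (InBlock (block_view h) (payload_hash h) (header_qc h))).

(* What the data format alone says of a block and of a proposal, without any
   signature; see [valid_block] and [valid_proposal] for validity. *)
Definition wf_block (B : block) :=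
  correct_hash B && (payload_hash B == H (InPayload (payload B))).
Definition wf_proposal (p : proposal) :=
  wf_block (prop_block p)
  && (prop_id p == id_of (block_hash (prop_block p)) (prop_view p)).

Definition valid_qc (q : qc) :=
  (q == genesis_qc)
  || (qc_id q == id_of (qc_block_hash q) (qc_view q))
     && aggregate_ok (fun=> SVote (qc_view q) (qc_block_hash q) (qc_id q))
                     (qc_sigma q).

Definition valid_vote (x : vote f Hash) :=
  (vote_id x == id_of (vote_block_hash x) (vote_view x))
  && ((vote_sigma x).2 == SVote (vote_view x) (vote_block_hash x) (vote_id x)).

Definition valid_header (h : header) :=
  valid_qc (header_qc h) && correct_hash h.
Definition valid_block (B : block) :=
  valid_header B && (payload_hash B == H (InPayload (payload B))).

Definition valid_nec (n : nec) :=
  ((high_tip_qc_view n).+1 < nec_view n)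
  && aggregate_ok (fun=> SNE (nec_view n) (high_tip_qc_view n)) (nec_sigma n).

Definition is_genesis_tip (T : tip) :=
  let: Tip v p h _ c n := T in
  [&& v == 0, p == id_of genesis_hash 0, h == genesis_header,
      ~~ isSome c & ~~ isSome n].

(* [valid_tip] is the validity of fresh tips. *)
Fixpoint valid_tip (T : tip) : bool :=
  is_genesis_tip T ||
  let: Tip v p h s oc on := T in
  [&& valid_header h, p == id_of (block_hash h) v,
      s == Some (leader f v, SProposal p),
      block_view h == v, qc_view (header_qc h) < v &
      if v == (qc_view (header_qc h)).+1 then ~~ isSome oc && ~~ isSome on
      else if oc is Some c then
        [&& valid_tc c, v == (tc_view c).+1 &
            match on with
            | None => if high_qc c is Some q then header_qc h == q else false
            | Some n => [&& valid_nec n, v == nec_view n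
                          & qc_view (header_qc h) == high_tip_qc_view n]
            end]
      else false]
with valid_tc (c : tc) : bool :=
  let: TC v tips qcs oT oq Sig := c in
  let max_tips := \max_(s <- Sig) odflt 0 (tips s.1) in
  let max_qcs := \max_(s <- Sig) qcs s.1 in
  aggregate_ok (fun i => STimeout v (tips i) (qcs i)) Sig &&
  match oq, oT with
  | Some q, None =>
      [&& valid_qc q, qc_view q < v, max_tips <= qc_view q
        & qc_view q == max_qcs]
  | None, Some T =>
      [&& valid_tip T, tip_view T <= v,
          all (fun s => if tips s.1 is Some t then
                 [&& qcs s.1 < t, t <= tip_view T
                   & ~~ ((t == tip_view T) && (tip_qc_view T < qcs s.1))]
               else true) Sig
        & max_qcs < tip_view T]
  | _, _ => false
  end.

Definition fresh (p : proposal) :=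
  [|| (qc_view (header_qc (prop_block p))).+1 == prop_view p,
      isSome (prop_nec p)
    | if prop_tc p is Some c then isSome (high_qc c) else false].

Definition valid_proposal (p : proposal) :=
  [&& valid_block (prop_block p),
      prop_id p == id_of (block_hash (prop_block p)) (prop_view p),
      prop_sigma p == Some (leader f (prop_view p), SProposal (prop_id p)),
      block_view (prop_block p) <= prop_view p,
      qc_view (header_qc (prop_block p)) < prop_view p &
      if fresh p then valid_tip (tip_of p)
      else (block_view (prop_block p) < prop_view p) &&
        if prop_tc p is Some c then
          [&& valid_tc c, prop_view p == (tc_view c).+1 &
              if high_tip c is Some T
              then block_header (prop_block p) == tip_header T else false]
        else false].

Definition valid_cert (c : cert f Hash) :=
  match c with CQC q => valid_qc q | CTC t => valid_tc t end.

Definition valid_timeout (M : timeout_msg f Hash) :=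
  (if tm_last_cer M is Some c
   then valid_cert c && ((cert_view c).+1 == tm_view M) else false) &&
  match tm_tip M, tm_qc M with
  | Some T, None =>
      [&& (if tm_tip_vote M is Some x
           then valid_vote x && (vote_view x == tm_view M) else false),
          valid_tip T, tip_view T <= tm_view M
        & (tm_sigma M).2
            == STimeout (tm_view M) (Some (tip_view T)) (tip_qc_view T)]
  | None, Some q =>
      [&& valid_qc q, qc_view q < tm_view M
        & (tm_sigma M).2 == STimeout (tm_view M) None (qc_view q)]
  | _, _ => false
  end.

(* Any well-formed proposal data counts, whether or not it was issued: a quorum
   of tip votes certifies a block in a view in which nobody need propose it. *)
Definition parent (B1 B2 : block) : Prop :=
  exists p : proposal, [/\ wf_proposal p, prop_block p = B1
                         & prop_id p = qc_id (header_qc B2)].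

Definition extends (B2 B1 : block) : Prop := clos_refl_trans block parent B1 B2.

End Validity.

Section Protocol.
Context (R : realType) (f : nat) (Payload : Type) (Hash : eqType).
Context (H : hash_input f Payload Hash -> Hash) (genesis_payload : Payload).
(* [theta_view], [theta_interval], [kappa]: the timer length, and the period and
   batch size of the requests of Recover. *)
Context (theta_view theta_interval : R) (kappa : nat).

Notation validator := (validator f).
Notation signature := (signature f Hash).
Notation qc := (qc f Hash).
Notation block := (block f Payload Hash).
Notation proposal := (proposal f Payload Hash).
Notation tip := (tip f Hash).
Notation tc := (tc f Hash).
Notation nec := (nec f Hash).
Notation vote := (vote f Hash).
Notation timeout_msg := (timeout_msg f Hash).
Notation cert := (cert f Hash).
Notation msg := (msg f Payload Hash).
Notation quorum := (quorum f).
Notation leader := (leader f).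
Notation id_of := (id_of H).
Notation genesis_qc := (genesis_qc H).

(* A running call of Recover: its TC, the view in which it was called, the
   validators already sent a ProposalRequest, the time of the last batch of
   these, and the NE signatures received. *)
Record recovery := Recovery {
  rec_tc : tc; rec_view : nat; rec_asked : seq validator; rec_time : R;
  rec_ne : seq signature }.

(* [store]: the proposals received or obtained; [qcs]: the QCs received or
   formed; [bqcs]: those on which BroadcastQC was run; [timer]: the time of the
   last restart; [sent]: all messages sent so far, with destination. *)
Record lstate := LState {
  cur_view : nat; local_tip : tip; highest_voted_view : nat; last_qc : qc;
  last_tc : option tc; votes : seq vote; tip_votes : seq vote;
  timeouts : seq timeout_msg; timer : R; store : seq proposal; qcs : seq qc;
  bqcs : seq qc; recover : option recovery; committed : seq block;
  spec_committed : seq block; sent : seq (validator * msg) }.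

Definition set_view v t s := let: LState _ b c d e g h k _ m n o p q r u := s in
  LState v b c d e g h k t m n o p q r u.
Definition set_tip T s := let: LState a _ c d e g h k l m n o p q r u := s in
  LState a T c d e g h k l m n o p q r u.
Definition set_voted v s := let: LState a b _ d e g h k l m n o p q r u := s in
  LState a b v d e g h k l m n o p q r u.
Definition set_last_qc x s := let: LState a b c _ e g h k l m n o p q r u := s in
  LState a b c x e g h k l m n o p q r u.
Definition set_last_tc x s := let: LState a b c d _ g h k l m n o p q r u := s in
  LState a b c d (Some x) g h k l m n o p q r u.
Definition set_votes x s := let: LState a b c d e _ h k l m n o p q r u := s in
  LState a b c d e x h k l m n o p q r u.
Definition set_tip_votes x s :=
  let: LState a b c d e g _ k l m n o p q r u := s in
  LState a b c d e g x k l m n o p q r u.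
Definition set_timeouts x s := let: LState a b c d e g h _ l m n o p q r u := s in
  LState a b c d e g h x l m n o p q r u.
Definition set_store x s := let: LState a b c d e g h k l _ n o p q r u := s in
  LState a b c d e g h k l x n o p q r u.
Definition set_qcs x s := let: LState a b c d e g h k l m _ o p q r u := s in
  LState a b c d e g h k l m x o p q r u.
Definition set_bqcs x s := let: LState a b c d e g h k l m n _ p q r u := s in
  LState a b c d e g h k l m n x p q r u.
Definition set_recover x s := let: LState a b c d e g h k l m n o _ q r u := s in
  LState a b c d e g h k l m n o x q r u.
Definition set_committed x s :=
  let: LState a b c d e g h k l m n o p _ r u := s in
  LState a b c d e g h k l m n o p x r u.
Definition set_spec_committed x s :=
  let: LState a b c d e g h k l m n o p q _ u := s in
  LState a b c d e g h k l m n o p q x u.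
Definition set_sent x s := let: LState a b c d e g h k l m n o p q r _ := s in
  LState a b c d e g h k l m n o p q r x.

Definition init_state : lstate :=
  LState 0 (genesis_tip H genesis_payload) 0 genesis_qc None [::] [::] [::] 0%R
    [:: genesis_proposal H genesis_payload] [:: genesis_qc] [::] None [::] [::]
    [::].

(* The choices the protocol leaves open in one step: the payload of a block
   created in a given view, the order in which Recover asks the validators,
   the high tip and high QC among equally high ones, and the proposals obtained
   because a QC points to them. *)
Record choices := Choices {
  ch_payload : nat -> Payload; ch_order : seq validator; ch_tip : nat;
  ch_qc : nat; ch_obtained : seq proposal }.

Definition pick (A : Type) (k : nat) (l : seq A) : option A :=
  if l is x :: _ then Some (nth x l (k %% size l)) else None.
Definition add (A : eqType) (x : A) (l : seq A) :=
  if x \in l then l else rcons l x.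

Section Local.
Variables (self : validator) (now : R) (ch : choices).

Definition send (j : validator) (m : msg) s := set_sent (rcons (sent s) (j, m)) s.
Definition broadcast (m : msg) s :=
  foldl (fun s' j => send j m s') s (enum validator).

Definition sent_timeout (v : nat) s :=
  has (fun x => if x.2 is MTimeout M then tm_view M == v else false) (sent s).
Definition sent_tc (v : nat) s :=
  has (fun x => if x.2 is MTC c then tc_view c == v else false) (sent s).
Definition sent_ne (v : nat) s :=
  has (fun x => if x.2 is MNE w _ _ then w == v else false) (sent s).
Definition has_voted (p : Hash) s :=
  has (fun x => voted_id x.2 == Some p) (sent s).
Definition has_issued (v : nat) s :=
  has (fun x => if x.2 is MProposal p then
         (prop_view p == v)
         && (prop_sigma p == Some (self, SProposal (prop_id p)))
       else false) (sent s).

Definition learn (l : seq qc) s := set_qcs (qcs s ++ l) s.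
Definition lookup (p : Hash) s :=
  ohead [seq x <- store s | prop_id x == p].

Definition enter (c : cert) s :=
  if cur_view s <= cert_view c then
    let s1 := set_view (cert_view c).+1 now s in
    match c with CQC q => set_last_qc q s1 | CTC t => set_last_tc t s1 end
  else s.

Definition commit (q : qc) s :=
  if lookup (qc_id q) s is Some par then
    let pq := header_qc (prop_block par) in
    let s1 := if fresh par
              then set_spec_committed (prop_block par :: spec_committed s) s
              else s in
    if qc_view q == (qc_view pq).+1 then
      if lookup (qc_id pq) s is Some gp
      then set_committed (prop_block gp :: committed s1) s1 else s1
    else s1
  else s.

Definition broadcast_qc (q : qc) s :=
  if q \in bqcs s then s else broadcast (MQC q) (set_bqcs (q :: bqcs s) s).

Definition issue (v : nat) (B : block) (c : option tc) (n : option nec) s :=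
  let p := id_of (block_hash B) v in
  if has_issued v s then s
  else broadcast (MProposal (Proposal v p B (Some (self, SProposal p)) c n)) s.

Definition new_block (v : nat) (q : qc) : block :=
  let ph := H (InPayload (ch_payload ch v)) in
  Block (Header v ph q (H (InBlock v ph q))) (ch_payload ch v).

Definition propose_qc (q : qc) s :=
  issue (cur_view s) (new_block (cur_view s) q) None None s.

Definition request (r : recovery) s :=
  let js := take kappa [seq j <- ch_order ch | j \notin rec_asked r] in
  set_recover
    (Some (Recovery (rec_tc r) (rec_view r) (rec_asked r ++ js) now (rec_ne r)))
    (foldl (fun s' j => send j (MProposalRequest (rec_tc r)) s') s js).

(* A new call replaces a running call for a lower view, and is void while one
   for this view is running. *)
Definition start_recover (c : tc) s :=
  let running := if recover s is Some r then cur_view s <= rec_view r else false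
  in if running then s
     else request (Recovery c (cur_view s) [::] now [::])
                  (broadcast (MNERequest c) s).

Definition propose_tc (c : tc) s :=
  if has_issued (cur_view s) s then s
  else if high_qc c is Some q then
    issue (cur_view s) (new_block (cur_view s) q) (Some c) None s
  else if high_tip c is Some T then
    if ohead [seq p <- store s | block_header (prop_block p) == tip_header T]
       is Some p
    then issue (cur_view s) (prop_block p) (Some c) None s
    else start_recover c s
  else s.

Definition recover_proposal (p : proposal) s :=
  if recover s is Some r then
    if high_tip (rec_tc r) is Some T then
      if prop_id p == tip_id T then
        issue (rec_view r) (prop_block p) (Some (rec_tc r)) None
              (set_recover None s)
      else s
    else s
  else s.

Definition recover_ne (v qv : nat) (x : signature) s :=
  if recover s is Some r then
    if high_tip (rec_tc r) is Some T then
      if [&& v == (tc_view (rec_tc r)).+1, qv == tip_qc_view T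
           & x.2 == SNE v qv] then
        let l := add x (rec_ne r) in
        if quorum <= size l then
          issue (rec_view r)
                (new_block (rec_view r) (header_qc (tip_header T)))
                (Some (rec_tc r)) (Some (NEC v qv (take quorum l)))
                (set_recover None s)
        else set_recover (Some (Recovery (rec_tc r) (rec_view r) (rec_asked r)
                                         (rec_time r) l)) s
      else s
    else s
  else s.

Definition mk_vote (v : nat) (bh : Hash) : vote :=
  Vote v bh (id_of bh v) (self, SVote v bh (id_of bh v)).

Definition votes_with (p : Hash) (l : seq vote) := [seq x <- l | vote_id x == p].

(* [l] holds a quorum of valid votes with the proposal_id of [x]. *)
Definition mk_qc (x : vote) (l : seq vote) : qc :=
  QC (vote_view x) (vote_block_hash x) (vote_id x)
     [seq vote_sigma y | y <- take quorum (votes_with (vote_id x) l)].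

Definition tm_tip_view (M : timeout_msg) := omap (@tip_view f Hash) (tm_tip M).
Definition tm_qc_view (M : timeout_msg) :=
  match tm_tip M, tm_qc M with
  | Some T, _ => tip_qc_view T
  | None, Some q => qc_view q
  | None, None => 0
  end.

Definition mk_tc (v : nat) (l : seq timeout_msg) : tc :=
  let msg_of i := ohead [seq M <- l | (tm_sigma M).1 == i] in
  let tips := pmap (@tm_tip f Hash) l in
  let rqcs := pmap (@tm_qc f Hash) l in
  let high_tips :=
    [seq T <- tips | all (fun T' => (tip_view T' < tip_view T)
       || (tip_view T' == tip_view T) && (tip_qc_view T' <= tip_qc_view T)) tips]
  in
  let high_qcs := [seq q <- rqcs | all (fun q' => qc_view q' <= qc_view q) rqcs] in
  let oT :=
    if pick (ch_tip ch) high_tips is Some T then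
      if all (fun q => qc_view q < tip_view T) rqcs then Some T else None
    else None in
  TC v [ffun i => if msg_of i is Some M then tm_tip_view M else None]
       [ffun i => if msg_of i is Some M then tm_qc_view M else 0]
     oT (if oT is Some _ then None else pick (ch_qc ch) high_qcs)
     [seq tm_sigma M | M <- l].

Definition on_proposal (j : validator) (p : proposal) s :=
  if [&& valid_proposal H genesis_payload p, j == leader (prop_view p)
       & cur_view s <= prop_view p] then
    let q := header_qc (prop_block p) in
    let s1 := enter (if prop_tc p is Some c then CTC c else CQC q) s in
    let s2 :=
      if (qc_view q).+1 == prop_view p then
        send (leader (qc_view q)) (MQC q)
          (if self == leader (qc_view q) then broadcast_qc q s1 else s1)
      else s1 in
    let s3 := commit q s2 in
    if highest_voted_view s3 < prop_view p then
      let T := if fresh p then tip_of p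
               else if prop_tc p is Some c
                    then odflt (local_tip s3) (high_tip c) else local_tip s3 in
      let v := cur_view s3 in
      let x := MVote (mk_vote v (block_hash (tip_header T))) in
      set_voted v (send (leader v.+1) x (send (leader v) x (set_tip T s3)))
    else s3
  else s.

Definition on_vote (x : vote) s :=
  let v := vote_view x in
  if [&& valid_vote H x, cur_view s <= v
       & (self == leader v) || (self == leader v.+1)] then
    let s1 := set_votes (add x (votes s)) s in
    if quorum <= size (votes_with (vote_id x) (votes s1)) then
      let q := mk_qc x (votes s1) in
      let s2 := commit q (enter (CQC q) (learn [:: q] s1)) in
      if self == leader v then broadcast_qc q s2 else propose_qc q s2
    else s1
  else s.

Definition on_qc (j : validator) (q : qc) s :=
  let v := qc_view q in
  if valid_qc H q && (cur_view s <= v) then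
    let s1 := if j == leader v
              then send (leader v.+1) (MQC q) (commit q (enter (CQC q) s))
              else s in
    let s2 := if self == leader v then broadcast_qc q s1 else s1 in
    if self == leader v.+1
    then propose_qc q (commit q (enter (CQC q) s2)) else s2
  else s.

Definition do_timeout s :=
  let v := cur_view s in
  let T := local_tip s in
  let q := last_qc s in
  let c := if (qc_view q).+1 == v then Some (CQC q)
           else omap (@CTC f Hash) (last_tc s) in
  if sent_timeout v s then s
  else
    let M :=
      if tip_view T <= qc_view q then
        TimeoutMsg v None None (Some q) c (self, STimeout v None (qc_view q))
      else
        TimeoutMsg v (Some T) (Some (mk_vote v (block_hash (tip_header T))))
          None c (self, STimeout v (Some (tip_view T)) (tip_qc_view T)) in
    broadcast (MTimeout M) (set_voted v s).

Definition record_timeout (M : timeout_msg) s :=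
  if has (fun M' => (tm_view M' == tm_view M)
                    && ((tm_sigma M').1 == (tm_sigma M).1)) (timeouts s)
  then s else set_timeouts (rcons (timeouts s) M) s.

(* Processing of the certificate carried by a timeout message. *)
Definition on_timeout_cert (c : cert) s :=
  let v := cert_view c in
  let s1 := if c is CTC t then
              if sent_timeout v s || sent_tc v s then s else broadcast (MTC t) s
            else s in
  let s2 := enter c s1 in
  let s3 :=
    if (self == leader v.+1) && ~~ has_issued v.+1 s2 then
      match c with CQC q => propose_qc q s2 | CTC t => propose_tc t s2 end
    else s2 in
  if c is CQC q then
    let s4 := if self == leader v then broadcast_qc q s3 else s3 in
    commit q (send (leader v.+1) (MQC q) (send (leader v) (MQC q) s4))
  else s3.

Definition on_timeout_record (M : timeout_msg) s :=
  let v := tm_view M in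
  let s1 := record_timeout M s in
  let l := [seq M' <- timeouts s1 | tm_view M' == v] in
  let s2 := if f < size l then do_timeout s1 else s1 in
  if quorum <= size l then
    let c := mk_tc v (take quorum l) in
    let s3 := enter (CTC c) s2 in
    if self == leader v.+1 then propose_tc c s3 else s3
  else s2.

Definition on_timeout (M : timeout_msg) s :=
  if valid_timeout H genesis_payload M && (cur_view s <= tm_view M) then
    let s1 := if tm_last_cer M is Some c then on_timeout_cert c s else s in
    if isSome (tm_tip M) then
      if tm_tip_vote M is Some x then
        let s2 := set_tip_votes (add x (tip_votes s1)) s1 in
        if quorum <= size (votes_with (vote_id x) (tip_votes s2)) then
          let q := mk_qc x (tip_votes s2) in
          let s3 := commit q (enter (CQC q) (learn [:: q] s2)) in
          if self == leader (qc_view q).+1 then propose_qc q s3 else s3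
        else on_timeout_record M s2
      else s1
    else on_timeout_record M s1
  else s.

Definition on_tc (c : tc) s :=
  let v := tc_view c in
  if valid_tc H genesis_payload c && (cur_view s <= v) then
    let s1 := enter (CTC c) s in
    let s2 := if sent_tc v s1 || sent_timeout v s1 then s1
              else broadcast (MTC c) s1 in
    if self == leader v.+1 then propose_tc c s2 else s2
  else s.

Definition on_request (ne : bool) (j : validator) (c : tc) s :=
  let v := (tc_view c).+1 in
  if [&& valid_tc H genesis_payload c, j == leader v & cur_view s <= v] then
    if high_tip c is Some T then
      let s1 := enter (CTC c) s in
      if ne then
        if has_voted (tip_id T) s1 || sent_ne v s1 then s1
        else send j (MNE v (tip_qc_view T) (self, SNE v (tip_qc_view T))) s1
      else if lookup (tip_id T) s1 is Some p then send j (MProposal p) s1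
      else s1
    else s
  else s.

Definition handle (j : validator) (m : msg) s :=
  match m with
  | MProposal p =>
      on_proposal j p
        (if wf_proposal H genesis_payload p
         then recover_proposal p (set_store (rcons (store s) p) s) else s)
  | MVote x => on_vote x s
  | MQC q => on_qc j q s
  | MTimeout M => on_timeout M s
  | MTC c => on_tc c s
  | MProposalRequest c => on_request false j c s
  | MNERequest c => on_request true j c s
  | MNE v qv x => recover_ne v qv x s
  end.

Definition receive (j : validator) (m : msg) s :=
  handle j m (learn (msg_qcs m) (set_store (store s ++ ch_obtained ch) s)).

Definition start : lstate :=
  let s := enter (CQC genesis_qc) init_state in
  if self == leader 1 then propose_qc genesis_qc s else s.

End Local.

Record packet := Packet {
  pk_time : R; pk_from : validator; pk_to : validator; pk_msg : msg }.

(* [net]: all messages ever sent, in order; [dlv]: positions in [net] of those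
   delivered so far.  [states] is meaningful at correct validators only. *)
Record config := Config {
  states : validator -> lstate; net : seq packet; dlv : seq nat }.

Inductive event :=
| EDeliver of nat & choices
| ETimer of validator
| ERequest of validator & choices
| EByz of validator & validator & msg
| EIdle.

(* [cfg k] is the configuration before the [k]-th event, at time [time k]. *)
Record execution := Execution {
  cfg : nat -> config; ev : nat -> event; time : nat -> R }.

Section Executions.
Variables (Delta : R) (Byz : {set validator}).

Definition packets (now : R) (i : validator) (l : seq (validator * msg)) :=
  [seq Packet now i x.1 x.2 | x <- l].

Definition update (now : R) (c : config) (i : validator) (s : lstate)
    (d : seq nat) : config :=
  Config (fun j => if j == i then s else states c j)
         (net c ++ packets now i (drop (size (sent (states c i))) (sent s))) d.

Definition net_sigs (c : config) : seq signature :=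
  flatten [seq msg_sigs (pk_msg k) | k <- net c].

Definition unforged (c : config) (l : seq signature) :=
  all (fun x => (x.1 \in Byz) || (x \in net_sigs c)) l.

Definition obtained (s : lstate) (q : qc) : Prop :=
  valid_qc H q /\
  (q \in qcs s \/ exists2 p, List.In p (store s) & q = header_qc (prop_block p)).

(* On obtaining a QC a validator obtains the proposal it points to, and in turn
   the ancestors; such proposals are well formed and carry no forged signature,
   but need not carry any. *)
Definition legal (c : config) (ch : choices) (s' : lstate) : Prop :=
  [/\ perm_eq (ch_order ch) (enum validator),
      forall p, List.In p (ch_obtained ch) ->
        [/\ wf_proposal H genesis_payload p, unforged c (tip_sigs (tip_of p))
          & exists2 q, obtained s' q & points_to q p]
    & forall q, obtained s' q -> exists2 p, List.In p (store s') & points_to q p].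

Definition step (now : R) (c : config) (e : event) (c' : config) : Prop :=
  match e with
  | EDeliver k ch => exists pk : packet,
      let i := pk_to pk in
      let s' := receive i now ch (pk_from pk) (pk_msg pk) (states c i) in
      [/\ onth (net c) k = Some pk, k \notin dlv c, i \notin Byz, legal c ch s'
        & c' = update now c i s' (k :: dlv c)]
  | ETimer i =>
      let s := states c i in
      [/\ i \notin Byz, ~~ sent_timeout (cur_view s) s,
          now = (timer s + theta_view)%R
        & c' = update now c i (do_timeout i s) (dlv c)]
  | ERequest i ch => exists r : recovery,
      let s := states c i in
      [/\ i \notin Byz, recover s = Some r,
          now = (rec_time r + theta_interval)%R,
          perm_eq (ch_order ch) (enum validator)
        & c' = update now c i (request now ch r s) (dlv c)]
  | EByz b j m =>
      [/\ b \in Byz, unforged c (msg_sigs m)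
        & c' = Config (states c) (rcons (net c) (Packet now b j m)) (dlv c)]
  | EIdle => c' = c
  end.

Definition start_config (now : R) (ch : validator -> choices) : config :=
  let s i := start i now (ch i) in
  Config s (flatten [seq packets now i (sent (s i)) | i <- enum (~: Byz)]) [::].

Record is_execution (E : execution) : Prop := IsExecution {
  ex_start : exists ch, cfg E 0 = start_config (time E 0) ch;
  ex_step : forall k, step (time E k) (cfg E k) (ev E k) (cfg E k.+1);
  ex_time : forall k, (time E k <= time E k.+1)%R;
  ex_time_unbounded : forall t, exists k, (t < time E k)%R;
  (* pending timer events are not overrun *)
  ex_timer : forall k i, i \notin Byz ->
    let s := states (cfg E k) i in
    sent_timeout (cur_view s) s \/ (time E k <= timer s + theta_view)%R;
  ex_request : forall k i r, i \notin Byz ->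
    recover (states (cfg E k) i) = Some r ->
    (time E k <= rec_time r + theta_interval)%R;
  (* partial synchrony; with unbounded time this includes reliability *)
  ex_sync : exists GST : R, forall k l pk,
    onth (net (cfg E k)) l = Some pk ->
    pk_from pk \notin Byz -> pk_to pk \notin Byz ->
    (Num.max (pk_time pk) GST + Delta < time E k)%R -> l \in dlv (cfg E k)
}.

End Executions.

Definition sends (E : execution) (i : validator) (m : msg) : Prop :=
  exists k pk, [/\ List.In pk (net (cfg E k)), pk_from pk = i & pk_msg pk = m].

Definition proposes (E : execution) (i : validator) (p : proposal) : Prop :=
  [/\ i = leader (prop_view p), wf_proposal H genesis_payload p,
      prop_sigma p = Some (i, SProposal (prop_id p)) & sends E i (MProposal p)].

Definition votes_for (E : execution) (i : validator) (p : proposal) : Prop :=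
  exists2 m, sends E i m & voted_id m = Some (prop_id p).

(* Proposals are told apart by their proposal_id, which determines view and
   block.  Issuing a proposal means signing it: a signed tip can reach others
   inside a timeout message or a certificate without the payload. *)
Definition issues (E : execution) (i : validator) (v : nat) (bh : Hash) : Prop :=
  exists k, (i, SProposal (id_of bh v)) \in net_sigs (cfg E k).

Definition equivocates (E : execution) (i : validator) (v : nat) : Prop :=
  exists bh1 bh2, [/\ bh1 <> bh2, issues E i v bh1 & issues E i v bh2].

(* Committing a block commits its ancestors. *)
Definition commits (E : execution) (i : validator) (B : block) : Prop :=
  exists k B0, List.In B0 (committed (states (cfg E k) i))
               /\ extends H genesis_payload B0 B.

End Protocol.

(* Main.v *)
Require Import Defs.
From mathcomp Require Import all_boot all_order all_algebra.
From mathcomp Require Import reals.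

Set Implicit Arguments.
Unset Strict Implicit.
Unset Printing Implicit Defensive.

(* Every correct validator is described by the log of what it signed; a log has
   at most one vote per view, and a timeout reports the tip of the last direct
   vote.  Let f+1 correct validators vote for a block C in the view v in which it
   is new, and let a be the view of the QC in C.  By quorum intersection every
   later TC contains the report of one of them, so its high QC has view at least
   v, or its high tip is lexicographically at least (v, a) in (view, QC view).
   Hence every valid fresh tip of a view above v carries a QC of view at least a;
   an NEC is no exception, as one of its signers holds such a TC.  If the leader
   of v does not equivocate, the bound improves to v: a high tip of view v is
   then the tip of C, for which no voter of C signs a no-endorsement.

   Consequently all QCs of view at least v certify descendants of the given block
   B, by induction on views.  Let B' be committed by a QC of view w+1 for C whose
   own QC, of view w, certifies B'.  If w >= v, then B' is such a descendant.  If
   w+1 = v, then C = B.  If w+1 < v, the general bound applied to C shows that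
   all QCs of view at least w, and with them the QC in B, certify descendants of
   B'. *)

(** * Validity of blocks, tips and certificates *)

Section Validity.
Context (f : nat) (Payload : Type) (Hash : eqType).
Context (H : hash_input f Payload Hash -> Hash) (H_inj : injective H).
Context (genesis_payload : Payload).

Local Notation validator := (validator f).
Local Notation signature := (signature f Hash).
Local Notation qc := (qc f Hash).
Local Notation tip := (tip f Hash).
Local Notation tc := (tc f Hash).
Local Notation block := (block f Payload Hash).
Local Notation proposal := (proposal f Payload Hash).
Local Notation id_of := (id_of H).
Local Notation valid_qc := (valid_qc H).
Local Notation valid_tip := (valid_tip H genesis_payload).
Local Notation valid_tc := (valid_tc H genesis_payload).
Local Notation wf_block := (wf_block H genesis_payload).
Local Notation wf_proposal := (wf_proposal H genesis_payload).
Local Notation valid_header := (valid_header H genesis_payload).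
Local Notation correct_hash := (correct_hash H genesis_payload).
Local Notation parent := (parent H genesis_payload).
Local Notation extends := (extends H genesis_payload).

(** * Injectivity of hashing and the chain of ancestors *)

Lemma id_of_inj h1 v1 h2 v2 : id_of h1 v1 = id_of h2 v2 -> h1 = h2 /\ v1 = v2.
Proof. by move/H_inj => [-> ->]. Qed.

Lemma genesis_neq_InBlock v ph (q : qc) : genesis_hash H <> H (InBlock v ph q).
Proof. by move/H_inj. Qed.

(** The hash covers all other fields of a header. The two disjuncts of [correct_hash] cannot
    collide, because the genesis block has the hash of the separate string [InGenesis]. *)
Lemma correct_hash_inj h1 h2 :
  correct_hash h1 -> correct_hash h2 -> block_hash h1 = block_hash h2 -> h1 = h2.
Proof.
move=> /orP[/eqP->|/eqP e1] /orP[/eqP->|/eqP e2] //=.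
- by rewrite e2 => /genesis_neq_InBlock.
- by rewrite e1 => /esym/genesis_neq_InBlock.
move=> e; move: (e); rewrite e1 e2 => /H_inj.
case: h1 h2 e {e1 e2} => [v1 p1 q1 b1] [v2 p2 q2 b2] /= -> [-> -> ->] //.
Qed.

Lemma wf_block_inj (B1 B2 : block) :
  wf_block B1 -> wf_block B2 -> block_hash B1 = block_hash B2 -> B1 = B2.
Proof.
move=> /andP[c1 /eqP p1] /andP[c2 /eqP p2] /(correct_hash_inj c1 c2).
case: B1 B2 p1 p2 {c1 c2} => [h1 y1] [h2 y2] /= p1 p2 e.
by move: p2; rewrite -e p1 => /H_inj[->].
Qed.

(** A [proposal_id] determines the block hash, hence the block. So the parent relation is a partial
    function on children, and the ancestors of a block form a chain. *)
Lemma parent_inj (B1 B2 B : block) : parent B1 B -> parent B2 B -> B1 = B2.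
Proof.
case=> p1 [/andP[w1 /eqP i1] <- e1] [p2 [/andP[w2 /eqP i2] <- e2]].
apply: wf_block_inj w1 w2 _.
by move: e2; rewrite -e1 i1 i2 => /id_of_inj[->].
Qed.

Lemma extends_refl (B : block) : extends B B.
Proof. exact: Relation_Operators.rt_refl. Qed.

Lemma extends_trans (B1 B2 B3 : block) :
  extends B1 B2 -> extends B2 B3 -> extends B1 B3.
Proof. by move=> e1 e2; apply: Relation_Operators.rt_trans e2 e1. Qed.

Lemma extends_parent (B1 B2 B : block) :
  parent B1 B2 -> extends B1 B -> extends B2 B.
Proof.
by move=> p; apply: extends_trans; apply: Relation_Operators.rt_step.
Qed.

(** Both descents to [B] end with the same parent step unless one is trivial. The right-neighbour
    form of the closure exposes this last step, and the induction strips it from both. *)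
Lemma extends_comparable (B B1 B2 : block) :
  extends B B1 -> extends B B2 -> extends B1 B2 \/ extends B2 B1.
Proof.
move=> /Operators_Properties.clos_rt_rtn1_iff e1.
elim: e1 B2 => [|C D pCD e1 IH] B2; first by left.
move=> /Operators_Properties.clos_rt_rtn1_iff e2.
case: e2 pCD => [pCD|E D' pED e2 pCD].
  right; apply: extends_parent pCD _.
  exact/Operators_Properties.clos_rt_rtn1_iff.
move: e2; rewrite (parent_inj pED pCD) => e2.
by apply: IH; apply/Operators_Properties.clos_rt_rtn1_iff.
Qed.

Lemma valid_qc_id (q : qc) :
  valid_qc q -> qc_id q = id_of (qc_block_hash q) (qc_view q).
Proof. by case/orP => [/eqP->|/andP[/eqP]]. Qed.

(* The witness need not have been issued by anyone: [parent] only asks for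
   well-formed proposal data. *)
Lemma parent_qc (B1 B2 : block) :
  wf_block B1 -> valid_qc (header_qc B2) ->
  qc_block_hash (header_qc B2) = block_hash B1 -> parent B1 B2.
Proof.
move=> w v e; exists (Proposal (qc_view (header_qc B2)) (qc_id (header_qc B2))
  B1 None None None); split=> //.
by rewrite /wf_proposal /= w -e (valid_qc_id v) eqxx.
Qed.

Lemma wf_proposal_qc (p : proposal) (q : qc) :
  wf_proposal p -> valid_qc q -> prop_id p = qc_id q ->
  [/\ wf_block (prop_block p), block_hash (prop_block p) = qc_block_hash q
    & prop_view p = qc_view q].
Proof.
by move=> /andP[w /eqP ->] /valid_qc_id -> /id_of_inj[].
Qed.

(** * Content of the validity of tips and TCs *)

Lemma tip_sigsE v i h s c n : tip_sigs (Tip v i h s c n) =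
  header_sigs h ++ osig s ++ oapp_seq (@tc_sigs f Hash) c
    ++ oapp_seq (@nec_sigma f Hash) n.
Proof. by case: c. Qed.

(** The three ways in which a fresh tip can be justified. The inclusions transfer facts about
    signatures from the tip to the certificates inside it. *)
Variant fresh_tip_spec (T : tip) : Prop :=
| TipAfterQC of tip_view T = (tip_qc_view T).+1
| TipAfterTC c of valid_tc c & tip_view T = (tc_view c).+1
    & {subset tc_sigs c <= tip_sigs T} & high_qc c = Some (header_qc (tip_header T))
| TipAfterNEC c n of valid_tc c & tip_view T = (tc_view c).+1
    & {subset tc_sigs c <= tip_sigs T}
    & valid_nec n & nec_view n = tip_view T & tip_qc_view T = high_tip_qc_view n
    & {subset nec_sigma n <= tip_sigs T}.

Lemma header_sigs_sub (T : tip) :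
  {subset qc_sigma (header_qc (tip_header T)) <= tip_sigs T}.
Proof. by case: T => v i h s c n x /= xh; rewrite mem_cat xh. Qed.

Lemma valid_tip_header (T : tip) : valid_tip T -> valid_header (tip_header T).
Proof.
case: T => v i h s c n /= /orP[/and5P[_ _ /eqP-> _ _]|/and5P[] //].
by rewrite /valid_header /valid_qc /correct_hash /= !eqxx.
Qed.

Lemma valid_tip_view (T : tip) : valid_tip T -> block_view (tip_header T) = tip_view T.
Proof.
by case: T => v i h s c n /= /orP[/and5P[/eqP-> _ /eqP-> _ _]|/and5P[_ _ _ /eqP]].
Qed.

(** Positivity of the view excludes the genesis tip, which is valid without signature. *)
Lemma valid_tipP (T : tip) :
  valid_tip T -> 0 < tip_view T ->
  [/\ tip_id T = id_of (block_hash (tip_header T)) (tip_view T),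
      (leader f (tip_view T), SProposal (tip_id T)) \in tip_sigs T,
      tip_qc_view T < tip_view T & fresh_tip_spec T].
Proof.
case: T => v i h s oc on /= /orP[/and5P[/eqP-> //]|].
case/and5P=> vh /eqP-> /eqP-> /eqP vE /andP[lt sp] _.
split=> //; first by rewrite !mem_cat /= mem_head orbT.
case: ifP sp => [/eqP ve _|_]; first exact: TipAfterQC.
case: oc => // c /and3P[vc /eqP ve sp].
have sub : {subset tc_sigs c <= tip_sigs (Tip v (id_of (block_hash h) v) h
    (Some (leader f v, SProposal (id_of (block_hash h) v))) (Some c) on)}.
  by move=> x xc; rewrite tip_sigsE !mem_cat /= xc !orbT.
case: on sub sp => [n|] sub.
  move=> /and3P[vn /eqP nv /eqP qv]; apply: TipAfterNEC vc _ sub vn _ _ _ => //.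
  by move=> x xn; rewrite tip_sigsE !mem_cat /= xn !orbT.
case E: (high_qc c) => [q|//] /eqP e.
by apply: TipAfterTC vc _ sub _; rewrite //= E e.
Qed.

(** The maxima in the definition of a valid TC are replaced by bounds for each signer, the form in
    which the report of one chosen validator is used. *)
Variant tc_spec (c : tc) : Prop :=
| TCSpec (tips : validator -> option nat) (qcs : validator -> nat)
    (Sig : seq signature) of
    aggregate_ok (fun i => STimeout (tc_view c) (tips i) (qcs i)) Sig
  & {subset Sig <= tc_sigs c}
  & match high_qc c, high_tip c with
    | Some q, None =>
        [/\ valid_qc q, qc_view q < tc_view c, {subset qc_sigma q <= tc_sigs c}
          & forall s, s \in Sig ->
              odflt 0 (tips s.1) <= qc_view q /\ qcs s.1 <= qc_view q]
    | None, Some T =>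
        [/\ valid_tip T, tip_view T <= tc_view c, {subset tip_sigs T <= tc_sigs c}
          & forall s, s \in Sig -> qcs s.1 < tip_view T /\
              forall t, tips s.1 = Some t -> t <= tip_view T
                /\ (t = tip_view T -> qcs s.1 <= tip_qc_view T)]
    | _, _ => False
    end.

Lemma valid_tcP (c : tc) : valid_tc c -> tc_spec c.
Proof.
case: c => v tips qcs oT oq Sig /= /andP[ag sp].
apply: (TCSpec (tips := tips) (qcs := qcs) (Sig := Sig)) => //=.
  by move=> x xS; rewrite !mem_cat xS !orbT.
case: oq oT sp => [q|] [T|] //=.
  move=> /and4P[vq lt mt /eqP mq]; split=> //.
    by move=> x xq; rewrite mem_cat xq.
  move=> s sS; split.
    apply: leq_trans mt; exact: (leq_bigmax_seq (F := fun s => odflt 0 (tips s.1))).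
  by rewrite mq; exact: (leq_bigmax_seq (F := fun s => qcs s.1)).
move=> /and4P[vT le al mq]; split=> //.
  by move=> x xT; rewrite mem_cat xT.
move=> s sS; split.
  apply: leq_ltn_trans mq; exact: (leq_bigmax_seq (F := fun s => qcs s.1)).
move=> t e; have /allP/(_ s sS) := al; rewrite e.
case/and3P=> _ -> nt; split=> // et; move: nt.
by rewrite et eqxx /= -leqNgt.
Qed.

(** * Quorum intersection *)

Lemma aggregate_okP content (Sig : seq signature) :
  aggregate_ok content Sig ->
  [/\ uniq [seq s.1 | s <- Sig], size [seq s.1 | s <- Sig] = quorum f
    & forall i, i \in [seq s.1 | s <- Sig] -> (i, content i) \in Sig].
Proof.
case/and3P=> u /eqP sz /allP al; split=> //; first by rewrite size_map.
by move=> i /mapP[[j x] xS ->] /=; have /= /eqP <- := al _ xS.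
Qed.

(** Disjointness would give (2f+1) + (f+1) = 3f+2 distinct validators out of 3f+1. *)
Lemma quorum_meets (A : seq validator) (S : {set validator}) :
  uniq A -> size A = quorum f -> f < #|S| -> exists2 j, j \in A & j \in S.
Proof.
move=> u sz cS; apply/exists_inP; apply: contraT => /exists_inPn dis.
have : #|[set j in A] :|: S| <= (3 * f).+1.
  by rewrite -[X in _ <= X]card_ord max_card.
rewrite cardsU (_ : _ :&: _ = set0) ?cards0 ?subn0; last first.
  by apply/setP => j; rewrite !inE; apply/negbTE/negP => /andP[/dis/negP].
rewrite cardsE (card_uniqP u) sz /quorum => le.
move: (leq_trans (leq_add (leqnn _) cS) le).
by rewrite addSnnS (_ : 3 = 2 + 1)%N // mulnDl mul1n !addnS ltnS ltnn.
Qed.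

End Validity.

(** * Logs *)

(* What a correct validator signed: a direct vote in view [v], which makes [T]
   its local tip; a timeout of view [v] with local tip [T] and last QC [q]; an
   NE signature for view [v] in reply to a request carrying [c]. *)
Inductive action (f : nat) (Hash : eqType) :=
| AVote of nat & tip f Hash
| ATimeout of nat & tip f Hash & qc f Hash
| ANE of nat & tc f Hash.
Arguments AVote {f Hash} _ _.
Arguments ATimeout {f Hash} _ _ _.
Arguments ANE {f Hash} _ _.

Section Log.
Context (f : nat) (Payload : Type) (Hash : eqType).
Context (H : hash_input f Payload Hash -> Hash).
Context (genesis_payload : Payload).

Local Notation validator := (validator f).
Local Notation signature := (signature f Hash).
Local Notation qc := (qc f Hash).
Local Notation tip := (tip f Hash).
Local Notation tc := (tc f Hash).
Local Notation action := (action f Hash).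
Local Notation id_of := (id_of H).
Local Notation genesis_tip := (genesis_tip H genesis_payload).
Local Notation valid_tip := (valid_tip H genesis_payload).
Local Notation valid_tc := (valid_tc H genesis_payload).
Local Notation wf_block := (wf_block H genesis_payload).

(** * Logs in which every action was allowed *)

Definition action_view (a : action) :=
  match a with AVote v _ | ATimeout v _ _ | ANE v _ => v end.

(** The pair [(v, T)] stands for a vote in view [v] on the block of [T]. A timeout carries such a
    vote only if it reports its tip instead of its QC. *)
Definition ballot (a : action) : option (nat * tip) :=
  match a with
  | AVote v T => Some (v, T)
  | ATimeout v T q => if tip_view T <= qc_view q then None else Some (v, T)
  | ANE _ _ => None
  end.

Definition ballot_id (b : nat * tip) := id_of (block_hash (tip_header b.2)) b.1.

Definition ballot_content (b : nat * tip) : signed Hash :=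
  SVote b.1 (block_hash (tip_header b.2)) (ballot_id b).

Definition timeout_report (T : tip) (q : qc) : option nat * nat :=
  if tip_view T <= qc_view q then (None, qc_view q)
  else (Some (tip_view T), tip_qc_view T).

Definition ne_qc_view (c : tc) := oapp (@tip_qc_view f Hash) 0 (high_tip c).

Definition action_contents (a : action) : seq (signed Hash) :=
  oapp_seq (fun b => [:: ballot_content b]) (ballot a) ++
  match a with
  | AVote _ _ => [::]
  | ATimeout v T q =>
      [:: STimeout v (timeout_report T q).1 (timeout_report T q).2]
  | ANE v c => [:: SNE v (ne_qc_view c)]
  end.

(* A log lists the actions of a validator, the latest first. *)
Fixpoint last_tip (l : seq action) : tip :=
  match l with
  | AVote _ T :: _ => T
  | _ :: l' => last_tip l'
  | [::] => genesis_tip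
  end.

(** Logs do not record proposals, so a proposal signature counts as justified by convention. *)
Definition justified (l : seq action) (x : signed Hash) : Prop :=
  if x is SProposal _ then True
  else exists2 a, List.In a l & x \in action_contents a.

(** A direct vote in view [v] answers either a fresh proposal of that view or a reproposal, whose
    tip is the high tip of a TC of the preceding view. *)
Definition tip_origin (N : seq signature) (v : nat) (T : tip) : Prop :=
  tip_view T = v \/
  exists c, [/\ valid_tc c, v = (tc_view c).+1, high_tip c = Some T
              & {subset tc_sigs c <= N}].

(* [N] is the set of signatures on the network. *)
Definition enabled (N : seq signature) (a : action) (l : seq action) : Prop :=
  (forall b, List.In b l -> action_view b <= action_view a) /\
  match a with
  | AVote v T =>
      [/\ valid_tip T, 0 < v, tip_view T <= v & {subset tip_sigs T <= N}] /\
      [/\ tip_origin N v T,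
          exists2 B, wf_block B & block_header B = tip_header T
        & forall b, List.In b l ->
            if b is ANE _ _ then true else action_view b < v]
  | ATimeout v T q =>
      T = last_tip l /\ forall w U r, List.In (ATimeout w U r) l -> w < v
  | ANE v c =>
      exists T, [/\ valid_tc c, v = (tc_view c).+1, high_tip c = Some T,
        {subset tc_sigs c <= N}
      & forall a b, List.In a l -> ballot a = Some b -> ballot_id b <> tip_id T]
  end.

Fixpoint good_log (N : seq signature) (l : seq action) : Prop :=
  if l is a :: l' then enabled N a l' /\ good_log N l' else True.

Lemma good_log_mono (N N' : seq signature) l :
  {subset N <= N'} -> good_log N l -> good_log N' l.
Proof.
move=> sNN; elim: l => //= a l IH [[vw ea] gl]; split; last exact: IH.
split=> //; case: a ea {vw} => // [v T|v c].
  move=> [[vT v0 Tv sT] [oT wB bl]]; split; split=> //; first by move=> x /sT/sNN.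
  case: oT => [|[c [vc ve hc sc]]]; [by left|right].
  by exists c; split=> // x /sc/sNN.
by move=> [T [vc ve hT sc nb]]; exists T; split=> // x /sc/sNN.
Qed.

Section Histories.
Variables (N : seq signature).

(** Cuts the history at [a]: [l2] is the past in which [a] was enabled. The enabledness of the
    actions in [l1] bounds their views from below, strictly wherever a second action of that kind in
    one view is excluded. *)
Lemma good_log_split l a : good_log N l -> List.In a l ->
  exists l1 l2, [/\ l = l1 ++ a :: l2, enabled N a l2, good_log N l2
    & forall b, List.In b l1 -> action_view a <= action_view b /\
        match b with
        | AVote v _ => if a is ANE _ _ then true else action_view a < v
        | ATimeout v _ _ => if a is ATimeout w _ _ then w < v else true
        | _ => true
        end].
Proof.
elim: l => //= b l IH [eb gl] [<-|al].
  by exists [::], l; split.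
have [l1 [l2 [e ea g2 h]]] := IH gl al; exists (b :: l1), l2; split=> //.
  by rewrite e.
move=> c [<-|/h //]; case: eb => vb eb; split; first exact: vb.
case: b eb {vb} => // [v T [_ [_ _ /(_ _ al)]]|v T q [_]].
  by case: a {IH al ea e h}.
by case: a al {IH ea e h} => // w U r al /(_ _ _ _ al).
Qed.

Lemma ballot_pos l a v T : good_log N l -> List.In a l ->
  ballot a = Some (v, T) -> 0 < v.
Proof.
elim: l => //= b l IH [[vw eb] gl] [E|al] bE; last exact: IH bE.
rewrite {}E in vw eb; case: a vw eb bE {IH} => //= [w U|w U q] vw.
  by move=> [[_ w0 _ _] _] [<- _].
move=> [TE _]; case: ifP => // /negbT; rewrite -ltnNge => lt [<- _] {v T}.
(* The reported tip is above a QC view, hence not the genesis tip. So an earlier direct vote exists,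
   and its positive view bounds [v] from below. *)
have: 0 < tip_view (last_tip l) by rewrite -TE; apply: leq_ltn_trans lt.
elim: l gl vw {TE} => //= c l IH [[_ ec] gl] vw.
have := vw c (or_introl erefl).
case: c ec vw => [u V|u V r|u c] ec vw /= le.
- by move=> _; move: ec => [[_ u0 _ _] _]; apply: leq_trans le.
- by apply: IH => // d dl; apply: vw; right.
- by apply: IH => // d dl; apply: vw; right.
Qed.

(** A later direct vote would have a strictly larger view, so a direct vote in the highest view is
    the latest one. *)
Lemma last_tip_vote l v T : good_log N l -> List.In (AVote v T) l ->
  (forall b, List.In b l -> action_view b <= v) -> last_tip l = T.
Proof.
elim: l => //= a l IH [[vw ea] gl] [->//|al] le.
have lev b : List.In b l -> action_view b <= v by move=> bl; apply: le; right.
case: a vw ea le => [u U|u U q|u c] vw ea le; try exact: IH.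
move: ea => [_ [_ _ /(_ _ al)/=]].
by rewrite ltnNge (le (AVote u U) (or_introl erefl)).
Qed.

Lemma last_tipP l : good_log N l ->
  last_tip l = genesis_tip \/ exists v, List.In (AVote v (last_tip l)) l.
Proof.
elim: l => [|a l IH] /=; first by left.
move=> [_ /IH]; case: a => [v T _|v T q|v c]; first by right; exists v; left.
  by case; [left|move=> [w ?]; right; exists w; right].
by case; [left|move=> [w ?]; right; exists w; right].
Qed.

Lemma log_vote l v T : good_log N l -> List.In (AVote v T) l ->
  [/\ valid_tip T, 0 < v, tip_view T <= v & {subset tip_sigs T <= N}] /\
  (tip_origin N v T /\ exists2 B, wf_block B & block_header B = tip_header T).
Proof. by move=> g /(good_log_split g)[l1 [l2 [_ [_ [? [? ? ?]]] _ _]]]. Qed.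

Lemma log_timeout l v T q : good_log N l -> List.In (ATimeout v T q) l ->
  exists l1 l2, [/\ l = l1 ++ ATimeout v T q :: l2, T = last_tip l2, good_log N l2
    & forall b, List.In b l2 -> action_view b <= v].
Proof.
by move=> g /(good_log_split g)[l1 [l2 [e [vw [TE _]] g2 _]]]; exists l1, l2.
Qed.

Lemma genesis_tip_view : tip_view genesis_tip = 0. Proof. by []. Qed.

(** The tip vote in a timeout repeats an earlier direct vote: the local tip was set by one, as the
    genesis tip has view 0 and is never reported. *)
Lemma log_ballot l a v T : good_log N l -> List.In a l -> ballot a = Some (v, T) ->
  exists u, [/\ List.In (AVote u T) l, u <= v & u = v \/ exists q, a = ATimeout v T q].
Proof.
move=> g al; case: a al => //= [u U|u U q] al.
  by move=> [<- <-]; exists u; split=> //; left.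
case: ifP => // /negbT; rewrite -ltnNge => lt [<- <-] {v T}.
have [l1 [l2 [e TE g2 vw]]] := log_timeout g al.
have := last_tipP g2; rewrite -TE => -[E|[w wl]].
  by move: lt; rewrite E genesis_tip_view.
exists w; split; last by right; exists q.
  by rewrite e; apply/List.in_app_iff; right; right.
exact: (vw _ wl).
Qed.

(** At most one timeout per view, no direct vote after another vote or a timeout of the same view,
    and a timeout after a direct vote of its view repeats that vote. [key] compares the latest
    action with an older one. *)
Lemma ballot_inj l a1 a2 v T1 T2 : good_log N l ->
  List.In a1 l -> List.In a2 l ->
  ballot a1 = Some (v, T1) -> ballot a2 = Some (v, T2) -> T1 = T2.
Proof.
elim: l a1 a2 T1 T2 => //= a l IH a1 a2 T1 T2 [ea gl].
have key b U1 U2 : List.In b l ->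
      ballot a = Some (v, U1) -> ballot b = Some (v, U2) -> U1 = U2.
  move=> bl; case: a ea => //= [u U|u U q] [vw ea].
    move=> [ue <-] bE; rewrite ue in vw ea; case: ea => _ [_ _ /(_ _ bl)].
    case: b bl bE => //= [w V|w V r] bl; last case: ifP => // _.
      by move=> [-> _]; rewrite ltnn.
    by move=> [-> _]; rewrite ltnn.
  case: ea => TE nt; case: ifP => // _ [ue <-] bE; rewrite ue in vw nt.
  case: b bl bE => //= [w V|w V r] bl.
    (* A timeout after a direct vote of the same view: no view in the past is higher, so the last
       tip is the tip of this vote. *)
    move=> [we <-]; rewrite we in bl.
    by rewrite TE; apply: last_tip_vote bl _.
  by case: ifP => // _ [we _]; have := nt _ _ _ bl; rewrite we ltnn.
move=> [<-|i1] [<-|i2] e1 e2.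
- by move: e1; rewrite e2 => -[->].
- exact: key e2.
- by symmetry; apply: key e1.
- exact: IH e1 e2.
Qed.

End Histories.
End Log.

(** * The safety argument on logs *)

Section Safety.
Context (f : nat) (Payload : Type) (Hash : eqType).
Context (H : hash_input f Payload Hash -> Hash) (H_inj : injective H).
Context (genesis_payload : Payload).

Local Notation validator := (validator f).
Local Notation signature := (signature f Hash).
Local Notation qc := (qc f Hash).
Local Notation tip := (tip f Hash).
Local Notation block := (block f Payload Hash).
Local Notation proposal := (proposal f Payload Hash).
Local Notation action := (action f Hash).
Local Notation valid_qc := (valid_qc H).
Local Notation valid_tip := (valid_tip H genesis_payload).
Local Notation valid_tc := (valid_tc H genesis_payload).
Local Notation wf_block := (wf_block H genesis_payload).
Local Notation wf_proposal := (wf_proposal H genesis_payload).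
Local Notation extends := (extends H genesis_payload).
Local Notation good_log := (good_log H genesis_payload).

Context (Byz : {set validator}) (Byz_le : #|Byz| <= f).
Context (N : seq signature) (logs : validator -> seq action).

(** Unforgeability: a signature of a correct validator can only be used once it is on the
    network. *)
Definition known (l : seq signature) := all (fun x => (x.1 \in Byz) || (x \in N)) l.

Context (logs_good : forall i, i \notin Byz -> good_log N (logs i)).
Context (N_justified : forall x, x \in N -> x.1 \notin Byz ->
                         justified H (logs x.1) x.2).

Definition balloted (j : validator) (v : nat) (T : tip) :=
  exists2 a, List.In a (logs j) & ballot a = Some (v, T).

(** * From signatures to log entries; uniqueness of QCs *)

Lemma known_sub (l : seq signature) : {subset l <= N} -> known l.
Proof. by move=> s; apply/allP => x /s ->; rewrite orbT. Qed.

Lemma known_correct (l : seq signature) j x :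
  known l -> (j, x) \in l -> j \notin Byz -> justified H (logs j) x.
Proof.
move=> /allP k /k /= /orP[->//|xN] jB; exact: (N_justified xN).
Qed.

Lemma justified_vote j v h p : justified H (logs j) (SVote v h p) ->
  exists2 T, balloted j v T & block_hash (tip_header T) = h.
Proof.
case=> a al; rewrite mem_cat => /orP[|]; last first.
  by case: a {al} => [? ?|? ? ?|? ?]; rewrite ?inE.
case E: (ballot a) => [[u T]|] //=; rewrite inE => /eqP [-> -> _].
by exists T => //; exists a.
Qed.

Lemma justified_timeout j v t q : justified H (logs j) (STimeout v t q) ->
  exists T r, List.In (ATimeout v T r) (logs j) /\ (t, q) = timeout_report T r.
Proof.
case=> a al; rewrite mem_cat => /orP[|].
  by case E: (ballot a) => [[u T]|] //=; rewrite inE.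
case: a al => [? ?|u T r|? ?] al; rewrite ?inE // => /eqP[-> -> ->].
by exists T, r; split=> //; case: (timeout_report T r).
Qed.

Lemma justified_ne j v q : justified H (logs j) (SNE v q) ->
  exists2 c, List.In (ANE v c) (logs j) & q = ne_qc_view c.
Proof.
case=> a al; rewrite mem_cat => /orP[|].
  by case E: (ballot a) => [[u T]|] //=; rewrite inE.
by case: a al => [? ?|? ? ?|u c] al; rewrite ?inE // => /eqP[-> ->]; exists c.
Qed.

Lemma aggregate_correct content (Sig : seq signature) (S : {set validator}) :
  aggregate_ok content Sig -> known Sig -> f < #|S| ->
  (forall j, j \in S -> j \notin Byz) ->
  exists j, [/\ j \in S, (j, content j) \in Sig & justified H (logs j) (content j)].
Proof.
move=> /aggregate_okP[u sz sg] k cS cor.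
have [j jA jS] := quorum_meets u sz cS.
have jS' := sg _ jA; exists j; split=> //.
exact: known_correct k jS' (cor _ jS).
Qed.

(** At most f of the 2f+1 signers are Byzantine, which leaves f+1 correct ones. *)
Lemma correct_signers content (Sig : seq signature) :
  aggregate_ok content Sig -> known Sig ->
  exists2 S : {set validator}, f < #|S| &
    forall j, j \in S -> j \notin Byz /\ justified H (logs j) (content j).
Proof.
move=> /aggregate_okP[u sz sg] k.
exists ([set j in [seq s.1 | s <- Sig]] :\: Byz).
  rewrite cardsD cardsE (card_uniqP u) sz ltn_subRL.
  apply: (@leq_ltn_trans (f + f)); last by rewrite /quorum mul2n -addnn.
  by rewrite leq_add2r (leq_trans (subset_leq_card (subsetIr _ _))).
by move=> j; rewrite !inE => /andP[jB /sg js]; split=> //; apply: known_correct k js jB.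
Qed.

Lemma balloted_inj j v T1 T2 :
  j \notin Byz -> balloted j v T1 -> balloted j v T2 -> T1 = T2.
Proof. by move=> /logs_good g [a1 i1 e1] [a2 i2 e2]; apply: ballot_inj g i1 i2 e1 e2. Qed.

(** A reproposed tip is the high tip of a valid TC and lies strictly above the QC view reported by
    any of the signers, of whom there is at least one. *)
Lemma vote_tip_pos j v T : j \notin Byz -> List.In (AVote v T) (logs j) -> 0 < tip_view T.
Proof.
move=> /logs_good g /(log_vote g)[[vT v0 _ _] [[->//|[c [vc _ hT _]]] _]].
case: (valid_tcP vc) => tips qcs Sig /aggregate_okP[_ sz _] _.
rewrite hT; case: (high_qc c) => // -[_ _ _].
case: Sig sz => // s Sig _ /(_ s (mem_head _ _))[lt _].
exact: leq_ltn_trans lt.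
Qed.

Lemma ballotedP j v T : j \notin Byz -> balloted j v T ->
  [/\ valid_tip T, 0 < tip_view T, tip_view T <= v, {subset tip_sigs T <= N}
    & exists2 B, wf_block B & block_header B = tip_header T].
Proof.
move=> jB [a al aE]; have g := logs_good jB.
have [u [ul le _]] := log_ballot g al aE.
have [[vT _ Tu sN] [_ wB]] := log_vote g ul.
by split=> //; [exact: vote_tip_pos ul|exact: leq_trans le].
Qed.

Lemma header_qc_known (T : tip) : valid_tip T -> {subset tip_sigs T <= N} ->
  valid_qc (header_qc (tip_header T)) /\ known (qc_sigma (header_qc (tip_header T))).
Proof.
move=> vT sN; have /andP[vq _] := valid_tip_header vT; split=> //; apply: known_sub.
by move=> x /header_sigs_sub/sN.
Qed.

Lemma valid_qc_voters (q : qc) : valid_qc q -> known (qc_sigma q) ->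
  q = genesis_qc H \/ exists2 S : {set validator}, f < #|S| &
    forall j, j \in S -> j \notin Byz /\
      exists2 T, balloted j (qc_view q) T & block_hash (tip_header T) = qc_block_hash q.
Proof.
move=> /orP[/eqP->|/andP[_ ag]] k; [by left|right].
have [S cS sj] := correct_signers ag k; exists S => // j /sj[jB js]; split=> //.
exact: justified_vote js.
Qed.

Lemma valid_qc_meets (q : qc) (S : {set validator}) :
  valid_qc q -> known (qc_sigma q) -> 0 < qc_view q -> f < #|S| ->
  (forall j, j \in S -> j \notin Byz) ->
  exists j T, [/\ j \in S, balloted j (qc_view q) T
                & block_hash (tip_header T) = qc_block_hash q].
Proof.
move=> /orP[/eqP->//|/andP[_ ag]] k _ cS cor.
have [j [jS _ /justified_vote[T jT hT]]] := aggregate_correct ag k cS cor.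
by exists j, T.
Qed.

Lemma voters_ex (S : {set validator}) : f < #|S| -> exists j, j \in S.
Proof. by move=> c; apply/set0Pn; rewrite -card_gt0; apply: leq_ltn_trans c. Qed.

(** Any other QC of view 0 would contain a vote of a correct validator in view 0, but the tip of
    such a vote has a positive view at most that of the vote. *)
Lemma valid_qc_view0 (q : qc) :
  valid_qc q -> known (qc_sigma q) -> qc_view q = 0 -> q = genesis_qc H.
Proof.
move=> vq k e; case: (valid_qc_voters vq k) => // -[S /voters_ex[j jS] /(_ j jS)].
move=> [jB [T jT _]]; have [_ p le _ _] := ballotedP jB jT.
by move: (leq_trans p le); rewrite e.
Qed.

(** The f+1 correct voters of one QC meet the quorum of the other, and a correct validator votes for
    one tip per view. *)
Lemma valid_qc_uniq (q1 q2 : qc) : valid_qc q1 -> known (qc_sigma q1) ->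
  valid_qc q2 -> known (qc_sigma q2) -> qc_view q1 = qc_view q2 ->
  qc_block_hash q1 = qc_block_hash q2.
Proof.
move=> v1 k1 v2 k2 e; case: (posnP (qc_view q2)) => [z|p].
  have -> := valid_qc_view0 v2 k2 z; rewrite z in e.
  by have -> := valid_qc_view0 v1 k1 e.
case: (valid_qc_voters v1 k1) => [g|[S cS sj]]; first by move: p; rewrite -e g.
have [|j [T [jS jT <-]]] := valid_qc_meets v2 k2 p cS; first by move=> j /sj[].
by have [jB [U jU <-]] := sj j jS; rewrite (balloted_inj jB jU (T2 := T)) // e.
Qed.

(** * Locking: a block with f+1 correct votes in the view in which it is new *)

Section Lock.
Context (C : block) (C_wf : wf_block C) (S : {set validator}) (S_card : f < #|S|).
Local Notation v := (block_view C).
Local Notation a := (qc_view (header_qc C)).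
Context (S_correct : forall j, j \in S -> j \notin Byz).
Context (S_votes : forall j, j \in S ->
  exists2 T, balloted j v T & block_hash (tip_header T) = block_hash C).

(** The lexicographic order on (view, QC view), compared at [C]; TCs select their high tip by this
    order. *)
Definition high (T : tip) :=
  v < tip_view T \/ (tip_view T = v /\ a <= tip_qc_view T).

Lemma same_header (T : tip) : valid_tip T ->
  block_hash (tip_header T) = block_hash C -> tip_header T = C.
Proof.
move=> vT; have /andP[_ cT] := valid_tip_header vT; have /andP[cC _] := C_wf.
exact: (correct_hash_inj H_inj cT cC).
Qed.

Lemma voted_tip_high (T : tip) : valid_tip T ->
  block_hash (tip_header T) = block_hash C -> high T.
Proof.
move=> vT /(same_header vT) e; right.
by rewrite -(valid_tip_view vT) /tip_qc_view e.
Qed.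

(** The induction statement of [valid_tc_high], named so that the lemmas on votes and timeouts can
    assume it for smaller views. *)
Definition tc_high (w : nat) := forall c, valid_tc c -> {subset tc_sigs c <= N} ->
  tc_view c = w -> (forall q, high_qc c = Some q -> v <= qc_view q) /\
                   (forall T, high_tip c = Some T -> high T).

(** A direct vote in a view [u] above [v] is for a tip of view [u] or for the high tip of a TC of
    view at least [v], which is covered by induction. *)
Lemma vote_high j u T : j \in S -> (forall w, v <= w < u -> tc_high w) ->
  List.In (AVote u T) (logs j) -> v < u -> high T.
Proof.
move=> jS tch uT lt; have g := logs_good (S_correct jS).
have [_ [[e|[c [vc uE hT sN]]] _]] := log_vote g uT; first by left; rewrite e.
have ltc : v <= tc_view c < u by rewrite uE leqnn andbT -ltnS -uE.
by have [_ /(_ _ hT)] := tch _ ltc c vc sN erefl.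
Qed.

(** At the vote for [C] the local tip has the header of [C]. Only direct votes change it afterwards,
    and these are in views above [v]. *)
Lemma last_tip_high (l : seq action) : good_log N l ->
  (forall u U, List.In (AVote u U) l -> v < u -> high U) ->
  (exists b T, [/\ List.In b l, ballot b = Some (v, T)
                 & block_hash (tip_header T) = block_hash C]) ->
  high (last_tip H genesis_payload l).
Proof.
elim: l => [_ _ [b [T [[]]]]|b l IH] //= [[_ eb] gl] hi [d [T [dl dE hT]]].
have hi' u U : List.In (AVote u U) l -> v < u -> high U.
  by move=> ul; apply: hi; right.
have rec : List.In d l -> high (last_tip H genesis_payload l).
  by move=> dl'; apply: IH => //; exists d, T.
case: b eb dl hi => [u U|u U q|u c] eb dl hi.
- case: dl => [E|dl].
    by move: dE eb hT; rewrite -E => -[_ <-] [[vT _ _ _] _]; apply: voted_tip_high.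
  apply: (hi u); first by left.
  case: eb => _ [_ _ /(_ _ dl)].
  case: (d) dE => //= [w V [-> _] //|w V q].
  by case: ifP => // _ [-> _].
- case: dl => [E|//]; move: eb => [UE _].
  move: dE; rewrite -E /=; case: ifP => // /negbT lt [_ TE].
  rewrite -UE TE; apply: voted_tip_high => //.
  have := last_tipP gl; rewrite -UE TE => -[e|[w wl]].
    by move: lt; rewrite TE e.
  by case: (log_vote gl wl) => [[]].
- by case: dl => [E|//]; move: dE; rewrite -E.
Qed.

(** After a timeout of view [w] at least [v], no vote in view [v] is possible. So the vote for [C]
    is contained in the timeout or precedes it, and the local tip has been high since that vote. *)
Lemma timeout_high j w T q : j \in S -> (forall w', v <= w' < w -> tc_high w') ->
  v <= w -> List.In (ATimeout w T q) (logs j) -> high T.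
Proof.
move=> jS tch le tl; have g := logs_good (S_correct jS).
have [U [d dl dE] hU] := S_votes jS.
have [l1 [l2 [e [vw [TE _]] g2 later]]] := good_log_split g tl.
move: (dl); rewrite e => /List.in_app_iff[/later[]|[E|dl2]].
- case: d {dl} dE => //= [u V [-> _] _|u V r]; first by rewrite ltnNge le.
  by case: ifP => // _ [-> _] _; rewrite ltnNge le.
- have [vU _ _ _ _] := ballotedP (S_correct jS) (ex_intro2 _ _ d dl dE).
  move: dE; rewrite -E /=; case: ifP => // _ [_ ->]; exact: voted_tip_high.
- rewrite TE; apply: last_tip_high => //; last by exists d, U.
  move=> u V ul vu; apply: (vote_high jS _ _ vu); last first.
    by rewrite e; apply/List.in_app_iff; right; right.
  move=> w' /andP[vw' wu]; apply: tch; rewrite vw' (leq_trans wu) //.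
  exact: (vw _ ul).
Qed.

(** Some member of [S] contributed to the TC, and its local tip was high. If it reported a QC
    instead, the view of that QC was at least that of the tip. The bounds in a valid TC pass either
    report on to [high_qc] or [high_tip]. *)
Lemma valid_tc_high w : v <= w -> tc_high w.
Proof.
elim/ltn_ind: w => w IH le c vc sN we.
have [tips qcs Sig ag sub sp] := valid_tcP vc.
have kS : known Sig by apply: known_sub => x /sub/sN.
have [j [jS jSig /justified_timeout[T [r [tl rep]]]]] :=
  aggregate_correct ag kS S_card S_correct.
have hT : high T.
  rewrite we in tl; apply: timeout_high jS _ le tl => w' /andP[vw' lt]; exact: IH.
have Tv : v <= tip_view T by case: hT => [/ltnW|[->]].
case: (high_qc c) (high_tip c) sp => [q|] [U|] //= [vq lt _ bnd]; split=> // _ [<-].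
  have [] := bnd _ jSig; move: rep; rewrite /timeout_report /=.
  case: ifP => [le'|_] [-> ->] /= b1 b2; last exact: leq_trans Tv b1.
  exact: leq_trans (leq_trans Tv le') b2.
have [] := bnd _ jSig; move: rep; rewrite /timeout_report /=.
case: ifP => [le'|_] [-> ->] /= b1 b2.
  by left; apply: leq_ltn_trans b1; apply: leq_trans Tv le'.
have [leTU eqTU] := b2 _ erefl.
case: hT => [lt'|[e' ha]]; first by left; apply: leq_trans lt' leTU.
move: leTU; rewrite leq_eqVlt => /orP[/eqP eTU|]; last by rewrite e'; left.
by right; rewrite -eTU e'; split=> //; apply: leq_trans ha (eqTU eTU).
Qed.

Lemma balloted_high j u T : j \in S -> balloted j u T -> v < u -> high T.
Proof.
move=> jS [d dl dE] lt; have g := logs_good (S_correct jS).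
have tch w : v <= w < u -> tc_high w by move=> /andP[? _]; apply: valid_tc_high.
have [u' [ul _ [e|[q e]]]] := log_ballot g dl dE.
  by rewrite e in ul; apply: vote_high ul lt.
by rewrite e in dl; apply: timeout_high tch (ltnW lt) dl.
Qed.

(** * Bounds for the QCs in later fresh tips, and descent of later QCs *)

Section Threshold.
(* [u] is [v] when the leader of [v] does not equivocate, and the view of the
   parent of [C] otherwise; [no_ne] is the one place where this matters. *)
Variables (u : nat) (u_le : u <= v).
Hypothesis no_ne : forall j w c T, j \in S -> List.In (ANE w c) (logs j) ->
  v < w -> high_tip c = Some T -> valid_tip T -> {subset tip_sigs T <= N} ->
  tip_view T = v -> a <= tip_qc_view T -> u <= tip_qc_view T.

(** Induction on the view of the tip. A tip directly after a QC or with the high QC of a TC carries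
    a QC of view at least [v]. With an NEC, the QC view is that of an earlier high tip, to which the
    induction applies unless its view is [v]. *)
Lemma later_tip_qc_view (T : tip) : valid_tip T -> {subset tip_sigs T <= N} ->
  v < tip_view T -> u <= tip_qc_view T.
Proof.
have [n] := ubnP (tip_view T); elim: n T => // n IH T ltTn vT sN lt.
have tch c : valid_tc c -> {subset tc_sigs c <= tip_sigs T} ->
    tip_view T = (tc_view c).+1 -> tc_high (tc_view c).
  by move=> vc sc e; apply: valid_tc_high; rewrite -ltnS -e.
have [_ _ _] := valid_tipP vT (leq_ltn_trans (leq0n _) lt).
case=> [e|c vc e sc hq|c m vc e sc vm mv qv sm].
- by rewrite (leq_trans u_le) // -ltnS -e.
- have [/(_ _ hq) le _] := tch c vc sc e c vc (fun x xc => sN _ (sc _ xc)) erefl.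
  exact: leq_trans u_le le.
have /andP[_ ag] := vm.
have km : known (nec_sigma m) by apply: known_sub => x /sm/sN.
have [j [jS _ /justified_ne[d dl qE]]] := aggregate_correct ag km S_card S_correct.
(* NE signatures mention only the view and the QC view. So [d] is the TC that [j] itself answered,
   which may differ from the TC [c] in [T]. *)
have [l1 [l2 [lE [vw [U [vd dv hU sd nb]]] _ _]]] :=
  good_log_split (logs_good (S_correct jS)) dl.
have dv' : tip_view T = (tc_view d).+1 by rewrite -mv.
have led : v <= tc_view d by rewrite -ltnS -dv'.
have [_ /(_ _ hU) hi] := valid_tc_high led vd sd erefl.
have [tips qcs Sig _ _] := valid_tcP vd; rewrite hU.
case: (high_qc d) => // -[vU leU sU _].
have sUN : {subset tip_sigs U <= N} by move=> x /sU/sd.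
rewrite qv qE /ne_qc_view hU /=.
case: hi => [ltU|[eU aU]]; last by apply: no_ne dl _ hU _ _ _ _ => //; rewrite mv.
by apply: IH => //; rewrite -ltnS; apply: leq_trans ltTn; rewrite dv' !ltnS.
Qed.

Context (A : block).
Hypothesis base_qc : forall q, valid_qc q -> known (qc_sigma q) ->
  u <= qc_view q <= v ->
  exists D : block, [/\ wf_block D, block_hash D = qc_block_hash q & extends D A].
Hypothesis base_tip : forall T (D : block), valid_tip T -> {subset tip_sigs T <= N} ->
  tip_view T = v -> a <= tip_qc_view T -> wf_block D ->
  block_header D = tip_header T -> extends D A.

(** Induction on the view. Above [v], some member of [S] voted in [q], for a high tip. If the tip
    has view [v], [base_tip] applies; otherwise its own QC is above the threshold and earlier, and
    its block extends what that QC certifies. *)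
Lemma later_qc_extends (q : qc) : valid_qc q -> known (qc_sigma q) ->
  u <= qc_view q ->
  exists D : block, [/\ wf_block D, block_hash D = qc_block_hash q & extends D A].
Proof.
have [n] := ubnP (qc_view q); elim: n q => // n IH q ltqn vq kq le.
case: (leqP (qc_view q) v) => [lev|lt]; first by apply: base_qc; rewrite ?le.
have p := leq_ltn_trans (leq0n _) lt.
have [j [T [jS jT hT]]] := valid_qc_meets vq kq p S_card S_correct.
have [vT Tp Tq sN [D wD DE]] := ballotedP (S_correct jS) jT.
exists D; split=> //; first by rewrite DE.
case: (balloted_high jS jT lt) => [ltT|[eT aT]]; last exact: base_tip DE.
have leu := later_tip_qc_view vT sN ltT.
have [vh kh] := header_qc_known vT sN.
have [_ _ qT _] := valid_tipP vT Tp.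
have [|E [wE hE ex]] := IH _ _ vh kh leu.
  by rewrite -ltnS; apply: leq_trans ltqn; rewrite ltnS (leq_trans qT Tq).
by apply: extends_parent ex; apply: parent_qc => //; rewrite DE.
Qed.

End Threshold.
End Lock.

(** * Comparability with a committed block *)

Definition committable (B : block) : Prop := exists q (par gp : proposal),
  [/\ valid_qc q, known (qc_sigma q), wf_proposal par, prop_id par = qc_id q
    & qc_view q = (qc_view (header_qc (prop_block par))).+1] /\
  [/\ wf_proposal gp, prop_id gp = qc_id (header_qc (prop_block par))
    & B = prop_block gp].

(** The [Lock] section is used with [B] and [S] when the QC for [B'] has view at least that of [B].
    When [C] is new in a view below that of [B], it is used with [C] and the voters [S1] of the QC
    [q] for [C]. *)
Theorem committable_comparable (B B' : block) (S : {set validator}) :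
  wf_block B -> f < #|S| -> (forall j, j \in S -> j \notin Byz) ->
  (forall j, j \in S -> exists2 T, balloted j (block_view B) T
                                 & block_hash (tip_header T) = block_hash B) ->
  (forall T, valid_tip T -> {subset tip_sigs T <= N} ->
     tip_view T = block_view B -> block_hash (tip_header T) = block_hash B) ->
  committable B' -> extends B B' \/ extends B' B.
Proof.
move=> wB cS Scor Svote uniqB [q [par [gp [[vq kq wpar ipar qv] [wgp igp ->]]]]].
have [wC hC _] := wf_proposal_qc H_inj wpar vq ipar.
set C := prop_block par in qv igp wC hC *; set w := qc_view (header_qc C) in qv *.
have [g|[S1 c1 s1]] := valid_qc_voters vq kq; first by move: qv; rewrite g.
(* The tip voted for in [q] has view at most [w.+1] and above the view [w] of its own QC. So [C] is
   new in view [w.+1], the view of [q]. *)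
have vC j T : j \notin Byz -> balloted j (qc_view q) T ->
    block_hash (tip_header T) = block_hash C ->
    [/\ valid_qc (header_qc C), known (qc_sigma (header_qc C)) & block_view C = w.+1].
  move=> jB jT hT; have [vT Tp Tq sN _] := ballotedP jB jT.
  have TC := same_header wC vT hT.
  have [vh kh] := header_qc_known vT sN; have [_ _ lt _] := valid_tipP vT Tp.
  move: vh kh lt (valid_tip_view vT); rewrite /tip_qc_view TC => vh kh lt ->.
  by split=> //; apply/eqP; rewrite eqn_leq -qv Tq qv.
have [vpq kpq vCE] : [/\ valid_qc (header_qc C), known (qc_sigma (header_qc C))
    & block_view C = w.+1].
  have [j jS1] := voters_ex c1; have [jB [T jT hT]] := s1 j jS1.
  by apply: vC jB jT _; rewrite hT hC.
have [wB' hB' _] := wf_proposal_qc H_inj wgp vpq igp.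
set B0 := prop_block gp in wB' hB' *.
have B0C : parent H genesis_payload B0 C by exists gp.
have [j0 j0S] := voters_ex cS; have [T0 j0T0 hT0] := Svote j0 j0S.
have [vT0 T0p T0q sN0 _] := ballotedP (Scor _ j0S) j0T0.
have T0B := same_header wB vT0 hT0; have T0v := valid_tip_view vT0.
rewrite T0B in T0v.
have [lew|ltw] := leqP (block_view B) w.
  have base_tip T (D : block) : valid_tip T -> {subset tip_sigs T <= N} ->
      tip_view T = block_view B -> qc_view (header_qc B) <= tip_qc_view T ->
      wf_block D -> block_header D = tip_header T -> extends D B.
    move=> vT sN Tv _ wD DT; rewrite (wf_block_inj H_inj wD wB).
      exact: extends_refl.
    by rewrite DT; apply: uniqB.
  have base_qc q1 : valid_qc q1 -> known (qc_sigma q1) ->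
      block_view B <= qc_view q1 <= block_view B ->
      exists D : block, [/\ wf_block D, block_hash D = qc_block_hash q1 & extends D B].
    move=> v1 k1 /andP[le1 le2]; exists B; split=> //; last exact: extends_refl.
    have e1 : qc_view q1 = block_view B by apply/eqP; rewrite eqn_leq le1 le2.
    have q1p : 0 < qc_view q1 by rewrite e1 T0v.
    have [j [T [jS jT <-]]] := valid_qc_meets v1 k1 q1p cS Scor.
    have [U jU <-] := Svote j jS; rewrite e1 in jT.
    by rewrite (balloted_inj (Scor _ jS) jT jU).
  (* By uniqueness the high tip is that of [B]. The member [j] voted for [B] before its NE
     signature, as later actions have views at least [u]; but having voted for it forbids the
     signature, a contradiction. *)
  have no_ne j u c T : j \in S -> List.In (ANE u c) (logs j) ->
      block_view B < u -> high_tip c = Some T -> valid_tip T ->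
      {subset tip_sigs T <= N} -> tip_view T = block_view B ->
      qc_view (header_qc B) <= tip_qc_view T -> block_view B <= tip_qc_view T.
    move=> jS jc ltu cT vT sN Tv _.
    have [l1 [l2 [lE [_ [U [_ _ cU _ nb]]] _ later]]] :=
      good_log_split (logs_good (Scor _ jS)) jc.
    have [V [d dl dE] hV] := Svote j jS.
    move: cU; rewrite cT => -[TU]; rewrite -{}TU in nb.
    move: dl; rewrite lE => /List.in_app_iff[/later[le _]|[E|dl2]].
    - have dv : action_view d = block_view B.
        by case: (d) dE => //= [? ? [->]|? ? ?] //; case: ifP => // _ [->].
      by move: ltu; rewrite -dv ltnNge le.
    - by move: dE; rewrite -E.
    - case: (nb _ _ dl2 dE); rewrite /ballot_id /= hV.
      have [-> _ _ _] := valid_tipP vT (eq_ind_r (leq 1) T0p (etrans Tv T0v)).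
      by rewrite uniqB ?Tv.
  have [D [wD hD ex]] := later_qc_extends wB cS Scor Svote (leqnn _) no_ne
    base_qc base_tip vpq kpq lew.
  by right; rewrite (wf_block_inj H_inj wB' wD) // hD -hB'.
left; move: ltw; rewrite leq_eqVlt => /orP[/eqP wE|ltw].
  (* Here [q] has the view of [B], so a common voter identifies [C] with [B], whose parent is
     [B0]. *)
  have qp : 0 < qc_view q by rewrite qv.
  have [j [T [jS jT hT]]] := valid_qc_meets vq kq qp cS Scor.
  have [U jU hU] := Svote j jS; rewrite qv wE in jT.
  rewrite (wf_block_inj H_inj wB wC).
    by apply: extends_parent B0C (extends_refl _ _ _).
  by rewrite -hU hC -hT (balloted_inj (Scor _ jS) jT jU).
have S1cor j : j \in S1 -> j \notin Byz by move=> /s1[].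
have S1vote j : j \in S1 -> exists2 T, balloted j (block_view C) T
    & block_hash (tip_header T) = block_hash C.
  by move=> /s1[_ [T]]; rewrite qv vCE hC; exists T.
have le_w : w <= block_view C by rewrite vCE.
have ltT0 : block_view C < tip_view T0 by rewrite vCE -T0v.
have [vh kh] := header_qc_known vT0 sN0.
(* The QC of a tip of view [w.+1] has view at most [w]. With the lower bound its view is [w], and by
   uniqueness it certifies [B0]. *)
have base_tip T (D : block) : valid_tip T -> {subset tip_sigs T <= N} ->
    tip_view T = block_view C -> w <= tip_qc_view T ->
    wf_block D -> block_header D = tip_header T -> extends D B0.
  move=> vT sN Tv wT wD DT; have [vh' kh'] := header_qc_known vT sN.
  have Tp : 0 < tip_view T by rewrite Tv vCE.
  have [_ _ lt _] := valid_tipP vT Tp.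
  have e : tip_qc_view T = w.
    by apply/eqP; rewrite eqn_leq wT andbT -ltnS -vCE -Tv.
  apply: extends_parent (extends_refl _ _ _).
  by apply: parent_qc => //; rewrite DT // hB'; apply: valid_qc_uniq.
have base_qc q1 : valid_qc q1 -> known (qc_sigma q1) ->
    w <= qc_view q1 <= block_view C ->
    exists D : block, [/\ wf_block D, block_hash D = qc_block_hash q1 & extends D B0].
  move=> v1 k1 /andP[]; rewrite leq_eqVlt vCE => /orP[/eqP e1 _|lt1 le1].
    exists B0; split=> //; last exact: extends_refl.
    by rewrite hB'; apply: valid_qc_uniq.
  exists C; split=> //; last exact: extends_parent B0C (extends_refl _ _ _).
  rewrite hC; apply: valid_qc_uniq => //; rewrite qv.
  by apply/eqP; rewrite eqn_leq lt1 le1.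
(* The threshold is now the QC view of [C] itself, so the obligation on NE signers is its own
   hypothesis. *)
have no_ne j u c T : j \in S1 -> List.In (ANE u c) (logs j) ->
    block_view C < u -> high_tip c = Some T -> valid_tip T ->
    {subset tip_sigs T <= N} -> tip_view T = block_view C ->
    w <= tip_qc_view T -> w <= tip_qc_view T by [].
have wT0 := later_tip_qc_view wC c1 S1cor S1vote le_w no_ne vT0 sN0 ltT0.
have [D [wD hD ex]] := later_qc_extends wC c1 S1cor S1vote le_w no_ne
  base_qc base_tip vh kh wT0.
apply: extends_parent ex; rewrite T0B in vh hD.
exact: parent_qc.
Qed.

End Safety.

(** * The local invariant of correct validators *)

Section Lists.
Context (A B : Type).

Lemma In_filter (p : pred A) x l : List.In x [seq y <- l | p y] -> List.In x l /\ p x.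
Proof.
elim: l => //= y l IH; case: ifP => [py [<-|/IH[xl px]]|_ /IH[xl px]].
- by split=> //; left.
- by split=> //; right.
- by split=> //; right.
Qed.

Lemma In_ohead x (l : seq A) : ohead l = Some x -> List.In x l.
Proof. by case: l => //= y l [->]; left. Qed.

Lemma In_take n x (l : seq A) : List.In x (take n l) -> List.In x l.
Proof.
by elim: l n => [|y l IH] [|n] //= [->|/IH]; [left|right].
Qed.

Lemma In_pmap (g : A -> option B) y l :
  List.In y (pmap g l) -> exists2 x, List.In x l & g x = Some y.
Proof.
elim: l => //= x l IH; case E: (g x) => [z|] /=; last first.
  by move=> /IH[w wl e]; exists w => //; right.
by move=> [<-|/IH[w wl e]]; [exists x => //; left|exists w => //; right].
Qed.

Lemma In_cat x (l1 l2 : seq A) : List.In x (l1 ++ l2) <-> List.In x l1 \/ List.In x l2.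
Proof. exact: List.in_app_iff. Qed.

Lemma allIn (p : pred A) l : (forall x, List.In x l -> p x) -> all p l.
Proof.
elim: l => //= x l IH h; rewrite h /=; last by left.
by apply: IH => y yl; apply: h; right.
Qed.

End Lists.

Lemma In_nth A (x0 : A) l i : i < size l -> List.In (nth x0 l i) l.
Proof.
by elim: l i => // y l IH [|i] lt; [left|right; apply: IH].
Qed.

Lemma In_pick A k x (l : seq A) : Defs.pick k l = Some x -> List.In x l.
Proof. by case: l => // y l [<-]; apply: In_nth; rewrite ltn_mod. Qed.

Section LocalInvariant.
Context (R : realType) (f : nat) (Payload : Type) (Hash : eqType).
Context (H : hash_input f Payload Hash -> Hash) (H_inj : injective H).
Context (genesis_payload : Payload) (kappa : nat).

Local Notation validator := (validator f).
Local Notation signature := (signature f Hash).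
Local Notation tc := (tc f Hash).
Local Notation vote := (vote f Hash).
Local Notation block := (block f Payload Hash).
Local Notation proposal := (proposal f Payload Hash).
Local Notation timeout_msg := (timeout_msg f Hash).
Local Notation msg := (msg f Payload Hash).
Local Notation action := (action f Hash).
Local Notation lstate := (lstate R f Payload Hash).
Local Notation valid_qc := (valid_qc H).
Local Notation valid_vote := (valid_vote H).
Local Notation valid_tip := (valid_tip H genesis_payload).
Local Notation valid_tc := (valid_tc H genesis_payload).
Local Notation wf_block := (wf_block H genesis_payload).
Local Notation wf_proposal := (wf_proposal H genesis_payload).
Local Notation justified := (justified H).

Context (Byz : {set validator}) (N : seq signature).
Local Notation known := (known Byz N).
Context (self : validator) (now : R) (ch : choices f Payload Hash).
Context (l0 : seq action) (sent0 : seq (validator * msg)).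

(** The second clause concerns the bare [proposal_id] of a vote, because [votes_for] refers to it
    without looking at the signature. *)
Definition sendable (l : seq action) (m : msg) : Prop :=
  (forall x, x \in msg_sigs m ->
     (x.1 \in Byz) || (x \in N) \/ x.1 = self /\ justified l x.2) /\
  (forall p, voted_id m = Some p ->
     exists a b, [/\ List.In a l, ballot a = Some b & ballot_id H b = p]).

Definition good_votes (l : seq vote) :=
  [&& all valid_vote l, uniq l & known [seq vote_sigma x | x <- l]].

(* [l0] and [sent0] are the log and the sent messages at the start of the
   current step. *)
Record inv (l : seq action) (s : lstate) : Prop := Inv {
  inv_tip : local_tip s = last_tip H genesis_payload l;
  inv_log : good_log H genesis_payload N l;
  inv_view : forall a, List.In a l -> action_view a <= cur_view s;
  inv_voted : forall a, List.In a l ->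
    if a is ANE _ _ then true else action_view a <= highest_voted_view s;
  inv_timeout : forall v T q, List.In (ATimeout v T q) l -> sent_timeout v s;
  inv_ballot : forall a b, List.In a l -> ballot a = Some b ->
    has_voted (ballot_id H b) s;
  inv_sent : forall x, List.In x (sent s) -> sendable l x.2;
  inv_last_qc : known (qc_sigma (last_qc s));
  inv_last_tc : known (oapp_seq (@tc_sigs f Hash) (last_tc s));
  inv_votes : good_votes (votes s);
  inv_tip_votes : good_votes (tip_votes s);
  inv_timeouts : forall M, List.In M (timeouts s) ->
    known (msg_sigs (MTimeout M : msg));
  inv_store : forall p, List.In p (store s) ->
    wf_proposal p /\ known (tip_sigs (tip_of p));
  inv_recover : forall r, recover s = Some r ->
    known (tc_sigs (rec_tc r)) /\ known (rec_ne r);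
  inv_committed : forall B, List.In B (committed s) ->
    committable H genesis_payload Byz N B;
  inv_l0 : forall a, List.In a l0 -> List.In a l;
  inv_sent0 : exists t, sent s = sent0 ++ t }.

(** For the handlers that may sign a vote, a timeout or an NE message, and thereby extend the
    log. *)
Definition reached (s : lstate) : Prop := exists l, inv l s.

Lemma reach l s : inv l s -> reached s. Proof. by exists l. Qed.

Lemma known_cat l1 l2 : known (l1 ++ l2) = known l1 && known l2.
Proof. exact: all_cat. Qed.

Lemma known_subset (l1 l2 : seq signature) :
  {subset l1 <= l2} -> known l2 -> known l1.
Proof. by move=> s /allP k; apply/allP => x /s/k. Qed.

Lemma sendable_known l m : voted_id m = None -> known (msg_sigs m) -> sendable l m.
Proof.
move=> nv /allP k; split=> [x /k|p]; [by left|by rewrite nv].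
Qed.

Lemma sendable_cons a l m : sendable l m -> sendable (a :: l) m.
Proof.
move=> [k b]; split=> [x /k[|[e j]]|p /b[c [d [cl dE e]]]]; [by left|right|].
  split=> //; case: (x.2) j => //= >; by move=> [c cl]; exists c => //; right.
by exists c, d; split=> //; right.
Qed.

Lemma high_tip_sigs (c : tc) T : high_tip c = Some T -> {subset tip_sigs T <= tc_sigs c}.
Proof. by case: c => v t q oT oq S /= -> x xT; rewrite mem_cat xT. Qed.

Lemma high_qc_sigs (c : tc) q : high_qc c = Some q -> {subset qc_sigma q <= tc_sigs c}.
Proof. by case: c => v t q' oT oq S /= -> x xq; rewrite !mem_cat /= xq orbT. Qed.

(** * Operations that leave the log unchanged *)

Lemma inv_enter l c s : inv l s -> known (cert_sigs c) -> inv l (enter now c s).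
Proof.
move=> i k; rewrite /enter; case: ifP => // le.
have vw a : List.In a l -> action_view a <= (cert_view c).+1.
  by move=> /(inv_view i) h; apply: leq_trans h (leqW le).
by case: c k vw {le} => [q|t] k vw; case: s i => > [/= *]; constructor.
Qed.

Lemma inv_send l m j s : inv l s -> sendable l m -> inv l (send j m s).
Proof.
case: s => a b c d e g h i j' k m' n o p q t.
move=> [/= ? ? ? ? tm bl sn ? ? ? ? ? ? ? ? ? [u ue]] sm.
constructor=> //=.
- move=> v T r /tm; rewrite /sent_timeout /= has_rcons => ->; exact: orbT.
- move=> x y xl yE; have := bl _ _ xl yE; rewrite /has_voted /= has_rcons => ->.
  exact: orbT.
- by move=> x; rewrite -cats1 => /In_cat[/sn|[<-|[]]].
- by exists (rcons u (j, m)); rewrite ue rcons_cat.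
Qed.

Lemma inv_sends l m js s : inv l s -> sendable l m ->
  inv l (foldl (fun s' j => send j m s') s js).
Proof. by move=> + sm; elim: js s => //= j js IH s i; apply/IH/inv_send. Qed.

Lemma inv_broadcast l m s : inv l s -> sendable l m -> inv l (broadcast m s).
Proof. exact: inv_sends. Qed.

Lemma inv_learn l x s : inv l s -> inv l (learn x s).
Proof. by case: s => > [/= *]; constructor. Qed.

Lemma inv_set_bqcs l x s : inv l s -> inv l (set_bqcs x s).
Proof. by case: s => > [/= *]; constructor. Qed.

Lemma inv_set_spec l x s : inv l s -> inv l (set_spec_committed x s).
Proof. by case: s => > [/= *]; constructor. Qed.

Lemma inv_set_recover l r s : inv l s ->
  (forall r', r = Some r' -> known (tc_sigs (rec_tc r')) /\ known (rec_ne r')) ->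
  inv l (set_recover r s).
Proof. by case: s => > [/= *]; constructor. Qed.

Lemma inv_set_votes l x s : inv l s -> good_votes x -> inv l (set_votes x s).
Proof. by case: s => > [/= *]; constructor. Qed.

Lemma inv_set_tip_votes l x s : inv l s -> good_votes x -> inv l (set_tip_votes x s).
Proof. by case: s => > [/= *]; constructor. Qed.

Lemma inv_set_timeouts l x s : inv l s ->
  (forall M, List.In M x -> known (msg_sigs (MTimeout M : msg))) ->
  inv l (set_timeouts x s).
Proof. by case: s => > [/= *]; constructor. Qed.

Lemma inv_set_store l x s : inv l s ->
  (forall p, List.In p x -> wf_proposal p /\ known (tip_sigs (tip_of p))) ->
  inv l (set_store x s).
Proof. by case: s => > [/= *]; constructor. Qed.

Lemma inv_set_committed l B s : inv l s ->
  committable H genesis_payload Byz N B -> inv l (set_committed (B :: committed s) s).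
Proof.
move=> i cB.
have cm C : List.In C (B :: committed s) -> committable H genesis_payload Byz N C.
  by case=> [<-//|/(inv_committed i)].
by case: s i cm => > [/= *]; constructor.
Qed.

Lemma inv_lookup l s p x : inv l s -> lookup p s = Some x ->
  [/\ wf_proposal x, known (tip_sigs (tip_of x)), prop_id x = p & List.In x (store s)].
Proof.
move=> i xE; have [xs /eqP e] := In_filter (In_ohead xE).
by have [] := inv_store i xs.
Qed.

Lemma inv_commit l q s : inv l s -> valid_qc q -> known (qc_sigma q) ->
  inv l (commit q s).
Proof.
move=> i vq kq; rewrite /commit; case E: (lookup _ _) => [par|] //.
have [wp _ ip _] := inv_lookup i E; cbv zeta.
set s1 := if fresh par then _ else s.
have i1 : inv l s1 by rewrite /s1; case: ifP => // _; apply: inv_set_spec.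
case: ifP => // /eqP qv; case E': (lookup _ _) => [gp|] //.
have [wg _ ig _] := inv_lookup i E'.
by apply: inv_set_committed => //; exists q, par, gp.
Qed.

Lemma inv_broadcast_qc l q s : inv l s -> known (qc_sigma q) -> inv l (broadcast_qc q s).
Proof.
move=> i k; rewrite /broadcast_qc; case: ifP => // _.
by apply: inv_broadcast; [apply: inv_set_bqcs|apply: sendable_known].
Qed.

Lemma inv_issue l v (B : block) c n s : inv l s -> known (header_sigs B) ->
  known (oapp_seq (@tc_sigs f Hash) c) -> known (oapp_seq (@nec_sigma f Hash) n) ->
  inv l (issue H self v B c n s).
Proof.
move=> i kB kc kn; rewrite /issue; case: ifP => // _; apply: inv_broadcast => //.
split=> // x; rewrite /msg_sigs /tip_of tip_sigsE !mem_cat => /or4P[].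
- by move: kB => /allP k /k; left.
- by rewrite inE => /eqP->; right.
- by move: kc => /allP k /k; left.
- by move: kn => /allP k /k; left.
Qed.

Lemma inv_propose_qc l q s : inv l s -> known (qc_sigma q) ->
  inv l (propose_qc H self ch q s).
Proof. by move=> i k; apply: inv_issue. Qed.

Lemma inv_request l r s : inv l s -> known (tc_sigs (rec_tc r)) -> known (rec_ne r) ->
  inv l (request kappa now ch r s).
Proof.
move=> i k1 k2; apply: inv_set_recover; last by move=> r' [<-].
by apply: inv_sends => //; apply: sendable_known.
Qed.

Lemma inv_start_recover l c s : inv l s -> known (tc_sigs c) ->
  inv l (start_recover kappa now ch c s).
Proof.
move=> i k; rewrite /start_recover; case: ifP => // _; apply: inv_request => //.
by apply: inv_broadcast => //; apply: sendable_known.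
Qed.

Lemma inv_propose_tc l c s : inv l s -> known (tc_sigs c) ->
  inv l (propose_tc H kappa self now ch c s).
Proof.
move=> i k; rewrite /propose_tc; case: ifP => // _.
case Eq: (high_qc c) => [q|].
  by apply: inv_issue => //; apply: known_subset k; apply: high_qc_sigs.
case ET: (high_tip c) => [T|] //.
case Ep: (ohead _) => [p|]; last exact: inv_start_recover.
have [ps _] := In_filter (In_ohead Ep); have [_ kp] := inv_store i ps.
apply: inv_issue => //; apply: known_subset kp.
exact: (@header_sigs_sub _ _ (tip_of p)).
Qed.

Lemma inv_recover_proposal l p s : inv l s -> known (tip_sigs (tip_of p)) ->
  inv l (recover_proposal H self p s).
Proof.
move=> i k; rewrite /recover_proposal; case Er: (recover s) => [r|] //.
have [kr _] := inv_recover i Er.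
case: (high_tip _) => // T; case: ifP => // _; apply: inv_issue => //.
  exact: inv_set_recover.
by apply: known_subset k; apply: (@header_sigs_sub _ _ (tip_of p)).
Qed.

Lemma known_rcons l x : known (rcons l x) = known [:: x] && known l.
Proof. by rewrite /known all_rcons /= andbT. Qed.

Lemma inv_recover_ne l v qv x s : inv l s -> known [:: x] ->
  inv l (recover_ne H self ch v qv x s).
Proof.
move=> i k; rewrite /recover_ne; case Er: (recover s) => [r|] //.
have [kr kn] := inv_recover i Er.
case ET: (high_tip _) => [T|] //; case: ifP => // _.
have ka : known (Defs.add x (rec_ne r)).
  by rewrite /Defs.add; case: ifP => // _; rewrite known_rcons k.
case: ifP => _; last by apply: inv_set_recover => // r' [<-].
apply: inv_issue => //=; first exact: inv_set_recover.
  by apply: known_subset kr => y /header_sigs_sub; apply: high_tip_sigs.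
by apply: known_subset ka => y /mem_take.
Qed.

Lemma good_votes_add x (L : seq vote) : good_votes L -> valid_vote x ->
  known [:: vote_sigma x] -> good_votes (Defs.add x L).
Proof.
move=> g vx kx; rewrite /Defs.add; case: ifP => // /negbT nx; case/and3P: g => vL uL kL.
by rewrite /good_votes all_rcons vx vL rcons_uniq nx uL map_rcons known_rcons kx kL.
Qed.

(** The [proposal_id] fixes view and block hash, and with them the signed content; only the signer
    can differ. Hence distinct collected votes with one [proposal_id] have distinct signers. *)
Lemma valid_vote_inj (x y : vote) : valid_vote x -> valid_vote y ->
  vote_id x = vote_id y -> (vote_sigma x).1 = (vote_sigma y).1 -> x = y.
Proof.
case: x y => [v h i [j c]] [v' h' i' [j' c']].
rewrite /Defs.valid_vote /= => /andP[/eqP-> /eqP->] /andP[/eqP-> /eqP->].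
by move=> /(id_of_inj H_inj)[-> ->] ->.
Qed.

Lemma valid_mk_qc (x : vote) (L : seq vote) : good_votes L -> valid_vote x ->
  quorum f <= size (votes_with (vote_id x) L) ->
  valid_qc (mk_qc x L) /\ known (qc_sigma (mk_qc x L)).
Proof.
move=> /and3P[/allP vL uL kL] vx sz; split; last first.
  apply: known_subset kL => y /mapP[z /mem_take]; rewrite mem_filter => /andP[_ zL] ->.
  exact: map_f.
have memL z : z \in take (quorum f) (votes_with (vote_id x) L) ->
    vote_id z = vote_id x /\ valid_vote z.
  by move=> /mem_take; rewrite mem_filter => /andP[/eqP-> /vL].
rewrite /Defs.valid_qc /=; apply/orP; right; apply/andP; split.
  by case/andP: vx.
apply/and3P; split.
- rewrite -map_comp map_inj_in_uniq; first by rewrite take_uniq // filter_uniq.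
  move=> y z /memL[yi vy] /memL[zi vz]; apply: valid_vote_inj => //.
  by rewrite yi zi.
- by rewrite size_map size_takel.
- apply/allP => _ /mapP[z /memL[zi vz] ->].
  have /andP[/eqP e1 /eqP->] := vz; have /andP[/eqP e2 _] := vx.
  move: (zi); rewrite e1 e2 => /(id_of_inj H_inj)[-> ->].
  by rewrite -e2.
Qed.

Lemma inv_on_vote l x s : inv l s -> known [:: vote_sigma x] ->
  inv l (on_vote H self now ch x s).
Proof.
move=> i k; rewrite /on_vote; case: ifP => // /and3P[vx _ _].
set s1 := set_votes _ s; have gv := good_votes_add (inv_votes i) vx k.
have e1 : votes s1 = Defs.add x (votes s) by rewrite /s1; case: (s).
have i1 : inv l s1 by apply: inv_set_votes.
case: ifP => //; rewrite e1 => sz; have [vq kq] := valid_mk_qc gv vx sz.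
have i2 : inv l (commit (mk_qc x (Defs.add x (votes s)))
    (enter now (CQC (mk_qc x (Defs.add x (votes s))))
      (learn [:: mk_qc x (Defs.add x (votes s))] s1))).
  by apply: inv_commit => //; apply: inv_enter => //; apply: inv_learn.
by case: ifP => _; [apply: inv_broadcast_qc|apply: inv_propose_qc].
Qed.

Lemma inv_on_qc l j q s : inv l s -> known (qc_sigma q) ->
  inv l (on_qc H self now ch j q s).
Proof.
move=> i k; rewrite /on_qc; case: ifP => // /andP[vq _].
set s1 := if j == _ then _ else s.
have i1 : inv l s1.
  rewrite /s1; case: ifP => // _; apply: inv_send; last exact: sendable_known.
  by apply: inv_commit => //; apply: inv_enter.
set s2 := if self == _ then _ else s1.
have i2 : inv l s2 by rewrite /s2; case: ifP => // _; apply: inv_broadcast_qc.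
case: ifP => // _; apply: inv_propose_qc => //.
by apply: inv_commit => //; apply: inv_enter.
Qed.

(** * Signing votes, timeouts and NE messages *)

Lemma broadcastE m (s : lstate) :
  broadcast m s = set_sent (sent s ++ [seq (j, m) | j <- enum validator]) s.
Proof.
rewrite /broadcast; elim: (enum _) s => [|j js IH] s /=.
  by rewrite cats0; case: s.
by rewrite IH; case: s {IH} => > /=; rewrite cat_rcons.
Qed.

Lemma has_broadcast (p : pred (validator * msg)) m : p (self, m) ->
  has p [seq (j, m) | j <- enum validator].
Proof.
by move=> pm; rewrite has_map; apply/hasP; exists self; rewrite ?mem_enum.
Qed.

(** The common form of all steps that extend the log. For a timeout or an NE signature [last_tip] is
    unchanged, so [set_tip] merely rewrites the present local tip. *)
Lemma inv_action l a s v ms :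
  inv l s -> enabled H genesis_payload N a l -> action_view a <= cur_view s ->
  (forall b, List.In b (a :: l) -> if b is ANE _ _ then true else action_view b <= v) ->
  (forall w T q, a = ATimeout w T q ->
     has (fun x => if x.2 is MTimeout M then tm_view M == w else false) ms) ->
  (forall b, ballot a = Some b ->
     has (fun x => voted_id x.2 == Some (ballot_id H b)) ms) ->
  (forall x, List.In x ms -> sendable (a :: l) x.2) ->
  inv (a :: l) (set_sent (sent s ++ ms)
    (set_voted v (set_tip (last_tip H genesis_payload (a :: l)) s))).
Proof.
case: s => cv lt hv lq ltc vs tvs tms tm st qs bq rc cm sc sn.
move=> [/= it il iv ivd itm ib isn iq itc ivo itv itms ist irc icm i0 [u iu]].
move=> ea av hvv tmo bal snd; constructor=> //=.
- by move=> b [<-//|/iv].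
- move=> w T q [/tmo|/itm]; rewrite /sent_timeout /= has_cat => ->; by rewrite ?orbT.
- move=> b c [<- /bal|bl /(ib _ _ bl)]; rewrite /has_voted /= has_cat => ->.
    by rewrite orbT.
  by [].
- by move=> x /In_cat[/isn/sendable_cons|/snd].
- by move=> b /i0; right.
- by exists (u ++ ms); rewrite iu catA.
Qed.

Lemma own_sendable l b : (exists2 a, List.In a l & ballot a = Some b) ->
  (self, ballot_content H b).1 = self /\ justified l (ballot_content H b).
Proof.
case=> a al aE; split=> //; exists a => //.
by rewrite mem_cat aE mem_head.
Qed.

Lemma inv_vote l T i j s : inv l s -> highest_voted_view s < cur_view s ->
  valid_tip T -> tip_view T <= cur_view s -> {subset tip_sigs T <= N} ->
  tip_origin H genesis_payload N (cur_view s) T ->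
  (exists2 B, wf_block B & block_header B = tip_header T) ->
  let x := MVote (mk_vote H self (cur_view s) (block_hash (tip_header T))) in
  reached (set_voted (cur_view s) (send i x (send j x (set_tip T s)))).
Proof.
move=> il lt vT Tv sT oT wB x; apply: (@reach (AVote (cur_view s) T :: l)).
have -> : set_voted (cur_view s) (send i x (send j x (set_tip T s))) =
    set_sent (sent s ++ [:: (j, x); (i, x)]) (set_voted (cur_view s)
      (set_tip (last_tip H genesis_payload (AVote (cur_view s) T :: l)) s)).
  by case: (s) => > /=; rewrite -!cats1 -catA.
apply: inv_action => //=.
- split; first exact: inv_view il.
  split; split=> //; first exact: leq_ltn_trans lt.
  by move=> b bl; have := inv_voted il bl; case: b {bl} => //= [? ?|? ? ?] h;
    apply: leq_ltn_trans h lt.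
- move=> b [<-//=|bl]; have := inv_view il bl; by case: (b).
- by move=> b [<-]; rewrite /x /= /ballot_id /= eqxx.
- have sx : sendable (AVote (cur_view s) T :: l) x.
    split=> [y|p [<-]].
      rewrite inE => /eqP ->; right.
      by apply: (own_sendable (b := (_, T))); exists (AVote (cur_view s) T); first left.
    by exists (AVote (cur_view s) T), (cur_view s, T); split=> //; left.
  by move=> y [<-|[<-|[]]].
Qed.

Lemma last_tip_known l : good_log H genesis_payload N l ->
  known (tip_sigs (last_tip H genesis_payload l)).
Proof.
move=> g; case: (last_tipP g) => [->//|[v vl]].
by have [[_ _ _ sN] _] := log_vote g vl; apply: known_sub.
Qed.

Lemma reached_do_timeout l s : inv l s -> reached (do_timeout H self s).
Proof.
move=> i; rewrite /do_timeout; case: ifP => [_|/negbT nt]; first exact: reach i.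
set v := cur_view s; set T := local_tip s; set q := last_qc s.
set c := if _ then _ else omap _ _; set M := if _ then _ else _.
set a := ATimeout v T q.
apply: (@reach (a :: l)).
have TE : T = last_tip H genesis_payload l by apply: inv_tip i.
have -> : broadcast (MTimeout M) (set_voted v s) =
    set_sent (sent s ++ [seq (j, MTimeout M) | j <- enum validator])
      (set_voted v (set_tip (last_tip H genesis_payload (a :: l)) s)).
  by rewrite broadcastE /a /= -TE /T; case: (s).
have Mv : tm_view M = v by rewrite /M; case: ifP.
have kc : known (oapp_seq (@cert_sigs f Hash) c).
  rewrite /c; case: ifP => _; first exact: inv_last_qc i.
  by move: (inv_last_tc i); case: (last_tc s).
have Mid b : ballot a = Some b -> voted_id (MTimeout M : msg) = Some (ballot_id H b).
  by rewrite /a /M /=; case: ifP => // _ [<-].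
apply: inv_action => //=.
- split; first exact: inv_view i.
  (* A logged timeout of the current view would be among the sent messages, contrary to the guard of
     [do_timeout]. *)
  split=> // w U r wl; rewrite ltn_neqAle (inv_view i wl) andbT.
  apply: contraNneq nt => wv; rewrite -/v -wv; exact: inv_timeout i _ _ _ wl.
- by move=> b [<-//=|bl]; have := inv_view i bl; case: (b).
- by move=> w U r [<- _ _]; apply: has_broadcast; rewrite /= Mv eqxx.
- by move=> b /Mid bE; apply: has_broadcast; rewrite [X in X == _]bE.
have sM : sendable (a :: l) (MTimeout M).
  split=> [y|p]; last first.
    rewrite /M /= /ballot_id; case: ifP => //= le [<-].
    by exists a, (v, T); split=> //=; [left|rewrite le].
  have own z : z \in action_contents H a ->
      (self, z).1 = self /\ justified (a :: l) (self, z).2.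
    by move=> za; split=> //=; case: z za => // >; exists a => //; left.
  rewrite /M; case: ifP => le; rewrite /= !(mem_cat, inE).
    case/or3P => [yq|yc|/eqP->].
    - by left; move/allP: (inv_last_qc i); apply.
    - by left; move/allP: kc; apply.
    right; apply: own; rewrite mem_cat; apply/orP; right.
    by rewrite /= /timeout_report le inE.
  case/or4P => [yT|/eqP->|yc|/eqP->].
  - by left; move/allP: (last_tip_known (inv_log i)); apply; rewrite -TE.
  - by right; apply: own; rewrite mem_cat /= le inE eqxx.
  - by left; move/allP: kc; apply.
  right; apply: own; rewrite mem_cat; apply/orP; right.
  by rewrite /= /timeout_report le inE.
by move=> x; elim: (enum _) => //= j js IH [<-|/IH].
Qed.

(** The guard looks for votes among the sent messages; [inv_ballot] turns it into the statement
    about the log that [enabled] demands. *)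
Lemma reached_ne l s j c T : inv l s -> ~~ has_voted (tip_id T) s ->
  cur_view s = (tc_view c).+1 -> valid_tc c -> high_tip c = Some T ->
  {subset tc_sigs c <= N} ->
  let v := (tc_view c).+1 in
  reached (send j (MNE v (tip_qc_view T) (self, SNE v (tip_qc_view T))) s).
Proof.
move=> i nv cv vc hT sN v; set m := MNE _ _ _; pose a := ANE v c : action.
apply: (@reach (a :: l)).
have -> : send j m s = set_sent (sent s ++ [:: (j, m)])
    (set_voted (highest_voted_view s) (set_tip (last_tip H genesis_payload (a :: l)) s)).
  by rewrite /= -(inv_tip i) /send cats1; case: (s).
apply: inv_action => //=.
- split; first by move=> b /(inv_view i); rewrite cv.
  exists T; split=> // b d bl /(inv_ballot i bl) hv e.
  by rewrite -e hv in nv.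
- by rewrite cv.
- by move=> b [<-//|]; apply: inv_voted.
- move=> x [<-|[]] //; split=> // y; rewrite inE => /eqP->; right; split=> //=.
  by exists a; [left|rewrite mem_cat /= /ne_qc_view hT inE eqxx].
Qed.

(** * Handlers of proposals, requests, timeouts and TCs *)

Lemma enter_view c (s : lstate) : cur_view s <= (cert_view c).+1 ->
  cur_view (enter now c s) = (cert_view c).+1.
Proof.
rewrite leq_eqVlt /enter => /orP[/eqP e|]; first by rewrite e ltnn.
by rewrite ltnS => ->; case: c => ?; case: s.
Qed.

Lemma send_view j m (s : lstate) : cur_view (send j m s) = cur_view s.
Proof. by case: s. Qed.

Lemma broadcast_qc_view q (s : lstate) : cur_view (broadcast_qc q s) = cur_view s.
Proof. by rewrite /broadcast_qc; case: ifP => // _; rewrite broadcastE; case: s. Qed.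

Lemma commit_view q (s : lstate) : cur_view (commit q s) = cur_view s.
Proof.
rewrite /commit; case: (lookup _ _) => [par|] //; case: ifP => _; case: ifP => _;
  try (case: (lookup _ _) => [gp|]); by case: s.
Qed.

(** Ensures that after entering by the certificate of a proposal the current view is that of the
    proposal, so that the vote is cast there. *)
Lemma valid_proposal_cert (p : proposal) : valid_proposal H genesis_payload p ->
  let q := header_qc (prop_block p) in
  (cert_view (if prop_tc p is Some c then CTC c else CQC q)).+1 = prop_view p.
Proof.
case: p => v i [h y] s oc on /and5P[_ _ _ _ /andP[/= lt]].
case: ifP => [_|_ /andP[_]]; last by case: oc => // c /and3P[_ /eqP->].
case/orP => [/and5P[/eqP e]|/and5P[_ _ _ _ /andP[_]]]; first by rewrite e in lt.
case: ifP => [/eqP -> /andP[]|_]; first by case: oc.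
by case: oc => // c /and3P[_ /eqP->].
Qed.

(** A reproposal makes the high tip of its TC the local tip. The reproposed block has the same
    header, which provides the well-formed block. The default [T0] does not arise for a valid
    proposal. *)
Lemma valid_proposal_tip (p : proposal) T0 : valid_proposal H genesis_payload p ->
  {subset tip_sigs (tip_of p) <= N} ->
  let T := if fresh p then tip_of p
           else if prop_tc p is Some c then odflt T0 (high_tip c) else T0 in
  [/\ valid_tip T, tip_view T <= prop_view p, {subset tip_sigs T <= N},
      tip_origin H genesis_payload N (prop_view p) T
    & exists2 B, wf_block B & block_header B = tip_header T].
Proof.
move=> /and5P[/andP[/andP[vq ch'] ph] _ _ _ /andP[_ sp]] sN /=.
have wB : wf_block (prop_block p) by rewrite /Defs.wf_block ch' ph.
case: ifP sp => [_ vT|_ /andP[_]]; first by split=> //; [left|exists (prop_block p)].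
case Ec: (prop_tc p) => [c|] // /and3P[vc /eqP vE].
case hT: (high_tip c) => [T|] //= /eqP e.
have sc : {subset tc_sigs c <= N}.
  move=> x xc; apply: sN.
  by rewrite /tip_of tip_sigsE Ec !mem_cat; apply/or4P/Or43.
have [? ? ? _ _] := valid_tcP vc; rewrite hT; case: (high_qc c) => // -[vT le sT _].
split=> //.
- by rewrite vE leqW.
- by move=> x /sT/sc.
- by right; exists c.
- by exists (prop_block p).
Qed.

Lemma reached_on_proposal l j p s : inv l s -> {subset tip_sigs (tip_of p) <= N} ->
  reached (on_proposal H genesis_payload self now j p s).
Proof.
move=> i sN; rewrite /on_proposal; case: ifP => [/and3P[vp _ le]|_]; last exact: reach i.
set q := header_qc (prop_block p).
have kq : known (qc_sigma q).
  by apply: known_sub => x xq; apply: sN; apply: (@header_sigs_sub _ _ (tip_of p)).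
have vq : valid_qc q by case/andP: vp => /andP[/andP[]].
have cE := valid_proposal_cert vp.
set s1 := enter _ _ s.
have v1 : cur_view s1 = prop_view p by rewrite enter_view cE.
have i1 : inv l s1.
  apply: inv_enter => //; case Ec: (prop_tc p) => [c|] //; apply: known_sub => x xc.
  by apply: sN; rewrite /tip_of tip_sigsE Ec !mem_cat; apply/or4P/Or43.
set s2 := if _ == _ then _ else s1.
have [i2 v2] : inv l s2 /\ cur_view s2 = cur_view s1.
  rewrite /s2; case: ifP => // _; split.
    apply: inv_send; last exact: sendable_known.
    by case: ifP => // _; apply: inv_broadcast_qc.
  by rewrite send_view; case: ifP => // _; rewrite broadcast_qc_view.
set s3 := commit q s2.
have i3 : inv l s3 by apply: inv_commit.
have v3 : cur_view s3 = prop_view p by rewrite commit_view v2.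
case: ifP => [lt|_]; last exact: reach i3.
have [vT Tv sT oT wB] := valid_proposal_tip (local_tip s3) vp sN.
by rewrite -v3 in lt Tv oT; apply: inv_vote i3 lt vT Tv sT oT wB.
Qed.

Lemma reached_on_request l ne j c s : inv l s -> {subset tc_sigs c <= N} ->
  reached (on_request H genesis_payload self now ne j c s).
Proof.
move=> i sN; rewrite /on_request; case: ifP => [/and3P[vc _ le]|_]; last exact: reach i.
case hT: (high_tip c) => [T|]; last exact: reach i.
set s1 := enter _ _ _.
have i1 : inv l s1 by apply: inv_enter => //; apply: known_sub.
have v1 : cur_view s1 = (tc_view c).+1 by rewrite enter_view.
case: ne; last first.
  case E: (lookup _ _) => [p|]; last exact: reach i1.
  have [_ kp _ _] := inv_lookup i1 E.
  by apply: reach; apply: inv_send i1 _; apply: sendable_known.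
case: ifP => [_|/negbT]; first exact: reach i1.
by rewrite negb_or => /andP[nv _]; apply: reached_ne i1 nv v1 vc hT sN.
Qed.

(** The high tip, the high QC and the timeout signatures are all copied from recorded messages. *)
Lemma known_mk_tc v (L : seq timeout_msg) :
  (forall M, List.In M L -> known (msg_sigs (MTimeout M : msg))) ->
  known (tc_sigs (mk_tc (Payload := Payload) ch v L)).
Proof.
move=> kL; rewrite /mk_tc; cbv zeta.
set oT := match _ with Some _ => _ | None => None end.
rewrite [tc_sigs _]/= !known_cat; apply/and3P; split.
- have : forall T, oT = Some T -> known (tip_sigs T).
    move=> T; rewrite /oT; case E: (Defs.pick _ _) => [U|] //; case: ifP => // _ [<-].
    have [UT _] := In_filter (In_pick E); have [M ML MU] := In_pmap UT.
    by move: (kL M ML); rewrite /= MU known_cat => /andP[].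
  by case: (oT) => // T /(_ T erefl).
- case: (oT) => //; case E: (Defs.pick _ _) => [q|] //=.
  have [qL _] := In_filter (In_pick E); have [M ML Mq] := In_pmap qL.
  by move: (kL M ML); rewrite /= Mq !known_cat => /and4P[].
- rewrite /known all_map; apply: allIn => M /kL /=; rewrite !known_cat.
  by case/and5P => _ _ _ _; rewrite /known /= andbT.
Qed.

Lemma inv_record_timeout l M s : inv l s -> known (msg_sigs (MTimeout M : msg)) ->
  inv l (record_timeout M s).
Proof.
move=> i k; rewrite /record_timeout; case: ifP => // _; apply: inv_set_timeouts => //.
by move=> M'; rewrite -cats1 => /In_cat[/(inv_timeouts i)|[<-|[]]].
Qed.

Lemma inv_on_timeout_cert l c s : inv l s -> valid_cert H genesis_payload c ->
  known (cert_sigs c) -> inv l (on_timeout_cert H kappa self now ch c s).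
Proof.
move=> i vc kc; rewrite /on_timeout_cert.
set s1 := if c is CTC t then _ else s.
have i1 : inv l s1.
  rewrite /s1; case: c vc kc {s1} => // t vt kt; case: ifP => // _.
  by apply: inv_broadcast => //; apply: sendable_known.
set s2 := enter _ _ _; have i2 : inv l s2 by apply: inv_enter.
set s3 := if _ && _ then _ else s2.
have i3 : inv l s3.
  rewrite /s3; case: ifP => // _; case: (c) kc => [q|t] k.
    exact: inv_propose_qc.
  exact: inv_propose_tc.
clearbody s3; case: c vc kc {s1 s2 i1 i2} => // q vq kq.
apply: inv_commit => //; do 2 (apply: inv_send; last exact: sendable_known).
by case: ifP => // _; apply: inv_broadcast_qc.
Qed.

Lemma reached_on_timeout_record l M s : inv l s ->
  known (msg_sigs (MTimeout M : msg)) ->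
  reached (on_timeout_record H kappa self now ch M s).
Proof.
move=> i k; rewrite /on_timeout_record.
have i1 := inv_record_timeout i k.
set s1 := record_timeout M s in i1 *; set L := [seq _ <- timeouts s1 | _].
have kc : known
    (tc_sigs (mk_tc (Payload := Payload) ch (tm_view M) (take (quorum f) L))).
  apply: known_mk_tc => M' ML; apply: (inv_timeouts i1).
  by case: (In_filter (In_take ML)).
set s2 := if f < size L then _ else s1.
have [l' i2] : reached s2.
  by rewrite /s2; case: ifP => _; [apply: reached_do_timeout i1|apply: reach i1].
case: ifP => _; last exact: reach i2.
apply: (@reach l'); set s3 := enter _ _ _; have i3 : inv l' s3 by apply: inv_enter.
by case: ifP => // _; apply: inv_propose_tc.
Qed.

Lemma reached_on_timeout l M s : inv l s -> known (msg_sigs (MTimeout M : msg)) ->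
  reached (on_timeout H genesis_payload kappa self now ch M s).
Proof.
move=> i k; rewrite /on_timeout; case: ifP => [/andP[vM _]|_]; last exact: reach i.
set s1 := if tm_last_cer M is Some c then _ else s.
have i1 : inv l s1.
  rewrite /s1; case/andP: vM; case Ec: (tm_last_cer M) => [c|] // /andP[vc _] _.
  apply: inv_on_timeout_cert => //.
  by move: k; rewrite /= Ec !known_cat => /and5P[].
case ET: (tm_tip M) => [T|] /=; last exact: reached_on_timeout_record i1 k.
case Ex: (tm_tip_vote M) => [x|]; last exact: reach i1.
have [vx kx] : valid_vote x /\ known [:: vote_sigma x].
  case/andP: vM => _; rewrite ET Ex; case: (tm_qc M) => // /and4P[/andP[vx _] _ _ _].
  by split=> //; move: k; rewrite /= Ex !known_cat => /and5P[].
have gv := good_votes_add (inv_tip_votes i1) vx kx.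
set s2 := set_tip_votes _ s1.
have e2 : tip_votes s2 = Defs.add x (tip_votes s1) by rewrite /s2; case: (s1).
have i2 : inv l s2 by apply: inv_set_tip_votes.
case: ifP => [|_]; last exact: reached_on_timeout_record i2 k.
rewrite e2 => sz; have [vq kq] := valid_mk_qc gv vx sz; apply: (@reach l).
set s3 := commit _ _.
have i3 : inv l s3 by apply: inv_commit => //; apply: inv_enter => //; apply: inv_learn.
by case: ifP => // _; apply: inv_propose_qc.
Qed.

Lemma inv_on_tc l c s : inv l s -> known (tc_sigs c) ->
  inv l (on_tc H genesis_payload kappa self now ch c s).
Proof.
move=> i k; rewrite /on_tc; case: ifP => // /andP[vc _].
set s1 := enter _ _ _; have i1 : inv l s1 by apply: inv_enter.
set s2 := if _ || _ then s1 else _.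
have i2 : inv l s2.
  rewrite /s2; case: ifP => // _; apply: inv_broadcast => //; exact: sendable_known.
by case: ifP => // _; apply: inv_propose_tc.
Qed.

Lemma reached_handle l j m s : inv l s -> {subset msg_sigs m <= N} ->
  reached (handle H genesis_payload kappa self now ch j m s).
Proof.
move=> i sN; have k := known_sub Byz sN.
case: m sN k => [p|x|q|M|c|c|c|v qv x] sN k /=.
- have [l' i'] : reached (if wf_proposal p
      then recover_proposal H self p (set_store (rcons (store s) p) s) else s).
    case: ifP => wp; last exact: reach i.
    apply: (@reach l); apply: inv_recover_proposal => //; apply: inv_set_store => //.
    by move=> p'; rewrite -cats1 => /In_cat[/(inv_store i)|[<-|[]]].
  exact: reached_on_proposal i' sN.
- by apply: (@reach l); apply: inv_on_vote.
- by apply: (@reach l); apply: inv_on_qc.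
- exact: reached_on_timeout i k.
- by apply: (@reach l); apply: inv_on_tc.
- exact: reached_on_request i sN.
- exact: reached_on_request i sN.
- by apply: (@reach l); apply: inv_recover_ne.
Qed.

Lemma reached_receive l j m s : inv l s -> {subset msg_sigs m <= N} ->
  (forall p, List.In p (ch_obtained ch) ->
     wf_proposal p /\ known (tip_sigs (tip_of p))) ->
  reached (receive H genesis_payload kappa self now ch j m s).
Proof.
move=> i sN ob; apply: (@reached_handle l) sN; apply: inv_learn.
apply: inv_set_store => //.
by move=> p /In_cat[/(inv_store i)|/ob].
Qed.

End LocalInvariant.

(** * Executions *)

Lemma In_map A B (g : A -> B) y (l : seq A) :
  List.In y [seq g x | x <- l] -> exists2 x, List.In x l & y = g x.
Proof.
elim: l => //= x l IH [<-|/IH[z zl ->]]; first by exists x; first left.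
by exists z; first right.
Qed.

Lemma In_flatten A (x : A) ll :
  List.In x (flatten ll) -> exists2 l, List.In l ll & List.In x l.
Proof.
elim: ll => //= l ll IH /In_cat[xl|/IH[m ml xm]]; first by exists l; first left.
by exists m; first right.
Qed.

Lemma flatten_mapP A (B : eqType) (g : A -> seq B) (l : seq A) (y : B) :
  y \in flatten [seq g x | x <- l] <-> exists2 x, List.In x l & y \in g x.
Proof.
elim: l => [|x l IH] /=; first by split=> // -[].
rewrite mem_cat; split=> [/orP[yx|/IH[z zl yz]]|[z [<- ->//|zl yz]]].
- by exists x; first left.
- by exists z; first right.
- by apply/orP; right; apply/IH; exists z.
Qed.

Section Executions.
Context (R : realType) (f : nat) (Payload : Type) (Hash : eqType).
Context (H : hash_input f Payload Hash -> Hash) (H_inj : injective H).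
Context (genesis_payload : Payload).
Context (theta_view theta_interval : R) (kappa : nat).
Context (Delta : R) (Byz : {set validator f}).

Local Notation validator := (validator f).
Local Notation signature := (signature f Hash).
Local Notation action := (action f Hash).
Local Notation lstate := (lstate R f Payload Hash).
Local Notation config := (config R f Payload Hash).
Local Notation inv := (inv H genesis_payload Byz).
Local Notation reached := (reached H genesis_payload Byz).
Local Notation step := (step H genesis_payload theta_view theta_interval kappa Byz).

(** * Growth of the network and the global invariant *)

Lemma known_mono (N N' l : seq signature) :
  {subset N <= N'} -> known Byz N l -> known Byz N' l.
Proof.
move=> sN /allP k; apply/allP => x /k /orP[->//|/sN->]; exact: orbT.
Qed.

Lemma committable_mono (N N' : seq signature) B :
  {subset N <= N'} -> committable H genesis_payload Byz N B ->
  committable H genesis_payload Byz N' B.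
Proof.
move=> sN [q [par [gp [[vq kq wp ip qv] h]]]]; exists q, par, gp; split=> //.
by split=> //; apply: known_mono kq.
Qed.

(** Besides enlarging the network, this closes a step: the current log and sent messages become the
    baseline of the next one. *)
Lemma inv_mono (N N' : seq signature) i l0 sent0 l (s : lstate) :
  {subset N <= N'} -> inv N i l0 sent0 l s -> inv N' i l (sent s) l s.
Proof.
move=> sN [it il iv ivd itm ib isn iq itc ivo itv itms ist irc icm i0 ip].
have km := known_mono sN.
have gm L : good_votes H Byz N L -> good_votes H Byz N' L.
  by case/and3P=> v u k; apply/and3P; split=> //; apply: km.
constructor=> //; try exact: km; try exact: gm.
- exact: good_log_mono il.
- move=> x /isn[k v]; split=> // y /k[/orP[->|/sN->]|].
  + by left.
  + by left; rewrite orbT.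
  + by right.
- by move=> M /itms/km.
- by move=> p /ist[w /km].
- by move=> r /irc[/km k1 /km k2].
- by move=> B /icm; apply: committable_mono.
- by exists [::]; rewrite cats0.
Qed.

(** The logs are ghost data, absent from the configuration. The last two clauses tie the network to
    them. *)
Definition sound (c : config) (logs : validator -> seq action) : Prop :=
  [/\ forall i, i \notin Byz ->
        inv (net_sigs c) i (logs i) (sent (states c i)) (logs i) (states c i),
      forall pk p, List.In pk (net c) -> pk_from pk \notin Byz ->
        voted_id (pk_msg pk) = Some p -> exists a b,
          [/\ List.In a (logs (pk_from pk)), ballot a = Some b & ballot_id H b = p]
    & forall x, x \in net_sigs c -> x.1 \notin Byz -> justified H (logs x.1) x.2].

Lemma justified_incl (l l' : seq action) x :
  (forall a, List.In a l -> List.In a l') -> justified H l x -> justified H l' x.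
Proof. by move=> i; case: x => //= >; move=> [a /i al xa]; exists a. Qed.

(** The new packets are the suffix [t] of the messages sent by [i], all of them sendable. The log of
    [i] only grows, so earlier justifications persist. *)
Lemma sound_update c logs now i s d : sound c logs -> i \notin Byz ->
  reached (net_sigs c) i (logs i) (sent (states c i)) s ->
  exists logs', sound (update now c i s d) logs'.
Proof.
move=> [invs votes just] iB [l il].
have [t st] := inv_sent0 il; have i0 := inv_l0 il.
have dE : drop (size (sent (states c i))) (sent s) = t by rewrite st drop_size_cat.
exists (fun j => if j == i then l else logs j).
have grow j a : List.In a (logs j) -> List.In a (if j == i then l else logs j).
  by case: eqP => [->|//]; apply: i0.
have sN : {subset net_sigs c <= net_sigs (update now c i s d)}.
  by move=> x xN; rewrite /net_sigs map_cat flatten_cat mem_cat xN.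
have sentE x : List.In x t -> sendable H Byz (net_sigs c) i l x.2.
  by move=> xt; apply: (inv_sent il); rewrite st; apply/In_cat; right.
have newpk pk : List.In pk (packets now i t) ->
    pk_from pk = i /\ sendable H Byz (net_sigs c) i l (pk_msg pk).
  by move=> pkt; have [x xt ->] := In_map pkt; split=> //; apply: sentE.
split=> [j jB|pk p|x].
- rewrite /=; case: eqP => [->|_]; first exact: inv_mono il.
  exact: inv_mono (invs j jB).
- rewrite /= dE => /In_cat[pkN|/newpk[-> [_ sv]] _ /sv]; last by rewrite eqxx.
  by move=> pB /(votes _ _ pkN pB)[a [b [/grow al aE e]]]; exists a, b.
move=> xN xB; case/flatten_mapP: xN => pk /=; rewrite dE => /In_cat[pkN|/newpk[_ [sv _]]].
  move=> xpk; apply: justified_incl (grow _) _; apply: just => //.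
  by apply/flatten_mapP; exists pk.
case/sv => [|[-> jx]]; last by rewrite eqxx.
rewrite (negbTE xB) /= => xN.
by apply: justified_incl (grow _) _; apply: just.
Qed.

Lemma inv_start i now ch :
  inv [::] i [::] [::] [::] (start (R := R) H genesis_payload i now ch).
Proof.
have i0 : inv [::] i [::] [::] [::] (init_state R H genesis_payload).
  constructor=> //=; last by exists [::].
  by move=> p [<-|[]] //; rewrite /wf_proposal /wf_block /correct_hash /= !eqxx.
have i1 := inv_enter now i0 (c := CQC (genesis_qc H)) isT.
by rewrite /start; case: ifP => // _; apply: inv_propose_qc.
Qed.

Lemma sound_start now ch : exists logs,
  sound (start_config H genesis_payload Byz now ch) logs.
Proof.
exists (fun=> [::]).
have pkP pk : List.In pk (net (start_config H genesis_payload Byz now ch)) ->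
    sendable H Byz [::] (pk_from pk) [::] (pk_msg pk).
  move=> pkN; have [L Ll pkL] := In_flatten pkN; have [i _ LE] := In_map Ll.
  rewrite LE in pkL; have [x xs ->] := In_map pkL.
  by apply: (inv_sent (inv_start i now (ch i))).
split=> [i iB|pk p /pkP[_ sv] _ /sv //|x /flatten_mapP[pk /pkP[sv _]] /sv[|[_ //]]].
  exact: inv_mono (inv_start i now (ch i)).
by rewrite in_nil orbF => ->.
Qed.

Lemma sound_step now c e c' logs : step now c e c' -> sound c logs ->
  exists logs', sound c' logs'.
Proof.
move=> st sd; have [invs votes just] := sd.
case: e st => [k ch|i|i ch|b j m|] /=.
- case=> pk; set i := pk_to pk => -[pkE _ iB [_ ob _] ->].
  apply: (sound_update _ _ sd) => //.
  apply: (reached_receive H_inj kappa now _ (invs i iB)) => //.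
    have pkN : List.In pk (net c).
      by elim: (net c) k pkE => [|z l IH] [|k] //= => [[->]|/IH]; [left|right].
    by move=> x xpk; apply/flatten_mapP; exists pk.
  by move=> p /ob[w u _].
- case=> iB _ _ ->; apply: (sound_update _ _ sd) => //.
  exact: reached_do_timeout (invs i iB).
- case=> r [iB rE _ _ ->]; apply: (sound_update _ _ sd) => //.
  have [k1 k2] := inv_recover (invs i iB) rE.
  by exists (logs i); apply: (inv_request kappa now ch (invs i iB) k1 k2).
- case=> bB um ->; exists logs.
  have sN : {subset net_sigs c <= net_sigs (Config (states c)
      (rcons (net c) (Packet now b j m)) (dlv c))}.
    by move=> x xN; rewrite /net_sigs map_rcons flatten_rcons mem_cat xN.
  split=> [i iB|pk p|x].
  + exact: inv_mono (invs i iB).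
  + by rewrite /= -cats1 => /In_cat[pkN|[<-|[]] /=]; [apply: votes|rewrite bB].
  (* A Byzantine message can carry the signature of a correct validator only if it was on the
     network before. *)
  rewrite /net_sigs map_rcons flatten_rcons mem_cat => /orP[/just//|] /= xm xB.
  by move/allP: um => /(_ _ xm); rewrite (negbTE xB) => /just; apply.
- by move=> ->; exists logs.
Qed.

Lemma net_step now c e c' pk : step now c e c' ->
  List.In pk (net c) -> List.In pk (net c').
Proof.
by case: e => [k ch [p [_ _ _ _ ->]]|i [_ _ _ ->]|i ch [r [_ _ _ _ ->]]
  |b j m [_ _ ->]|->] //= pkN; rewrite -?cats1; apply/In_cat; left.
Qed.

Context (E : execution R f Payload Hash).
Context (E_exec : is_execution H genesis_payload theta_view theta_interval kappa
                               Delta Byz E).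

Lemma sound_execution k : exists logs, sound (cfg E k) logs.
Proof.
elim: k => [|k [logs sd]]; last exact: sound_step (ex_step E_exec k) sd.
by have [ch ->] := ex_start E_exec; apply: sound_start.
Qed.

Lemma net_mono k k' pk : k <= k' ->
  List.In pk (net (cfg E k)) -> List.In pk (net (cfg E k')).
Proof.
move=> /subnK <-; elim: (k' - k) => // d IH /IH; rewrite addSn.
exact: net_step (ex_step E_exec _).
Qed.

Lemma net_sigs_mono k k' : k <= k' ->
  {subset net_sigs (cfg E k) <= net_sigs (cfg E k')}.
Proof.
move=> le x /flatten_mapP[pk pkN xpk]; apply/flatten_mapP; exists pk => //.
exact: net_mono pkN.
Qed.

End Executions.

Theorem theorem2 (R : realType) (f : nat) (Payload : Type) (Hash : eqType)
    (H : hash_input f Payload Hash -> Hash) (H_inj : injective H)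
    (genesis_payload : Payload)
    (theta_view theta_interval : R) (kappa : nat)
    (Delta : R) (Delta_gt0 : (0 < Delta)%R)
    (Byz : {set validator f}) (Byz_le : #|Byz| <= f)
    (E : execution R f Payload Hash)
    (E_exec : is_execution H genesis_payload theta_view theta_interval kappa
                           Delta Byz E)
    (L : validator f) (p : proposal f Payload Hash)
    (L_proposes : proposes H genesis_payload E L p)
    (p_fresh : prop_view p = block_view (prop_block p))
    (S : {set validator f}) (S_card : f + 1 <= #|S|)
    (S_votes : forall j, j \in S -> j \notin Byz /\ votes_for E j p)
    (L_honest_view : ~ equivocates H E L (prop_view p))
    (i : validator f) (i_correct : i \notin Byz)
    (B' : block f Payload Hash)
    (B'_committed : commits H genesis_payload E i B') :
  extends H genesis_payload (prop_block p) B' \/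
  extends H genesis_payload B' (prop_block p).
Proof.
have [kc [B0 [B0c B0B']]] := B'_committed.
have [LE /andP[wB /eqP pid] psig [kp [ppk [ppkN _ ppkE]]]] := L_proposes.
(* The votes for [p] are sent at different times. The choice of a time for each voter yields one
   configuration [K] after all of them and after the commit, and the argument runs on the logs at
   [K]. *)
have /fin_all_exists[kv kvP] : forall j, exists k, j \in S -> exists pk,
    [/\ List.In pk (net (cfg E k)), pk_from pk = j
      & voted_id (pk_msg pk) = Some (prop_id p)].
  move=> j; case jS: (j \in S); last by exists 0.
  have [_ [m [k [pk [pkN pkj <-]]] mE]] := S_votes j jS.
  by exists k => _; exists pk.
pose K := maxn kc (\max_j kv j).
have [logs [invs votes just]] := sound_execution H_inj E_exec K.
have Scor j : j \in S -> j \notin Byz by move=> /S_votes[].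
have Sbal j : j \in S -> exists2 T, balloted logs j (prop_view p) T
    & block_hash (tip_header T) = block_hash (prop_block p).
  move=> jS; have [pk [pkN pkj pkE]] := kvP j jS.
  have leK : kv j <= K by rewrite leq_max (leq_bigmax j) orbT.
  have pkK := net_mono E_exec leK pkN.
  have pB : pk_from pk \notin Byz by rewrite pkj Scor.
  have [a [[v T] [al aE]]] := votes pk _ pkK pB pkE.
  rewrite pid => /(id_of_inj H_inj)[/= hT vE]; exists T => //.
  by exists a; rewrite -?pkj // -vE.
have cS : f < #|S| by rewrite -addn1.
have good j : j \notin Byz -> good_log H genesis_payload (net_sigs (cfg E K)) (logs j).
  by move=> jB; apply: inv_log (invs j jB).
have pv : 0 < prop_view p.
  have [j jS] := voters_ex cS; have [T [a al aE] _] := Sbal j jS.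
  exact: ballot_pos (good j (Scor j jS)) al aE.
have issB : issues H E L (prop_view p) (block_hash (prop_block p)).
  exists kp; apply/flatten_mapP; exists ppk => //.
  by rewrite ppkE /msg_sigs /tip_of tip_sigsE psig -pid !mem_cat mem_head orbT.
have uniqB T : valid_tip H genesis_payload T ->
    {subset tip_sigs T <= net_sigs (cfg E K)} ->
    tip_view T = block_view (prop_block p) ->
    block_hash (tip_header T) = block_hash (prop_block p).
  (* A valid tip carries the signature of the leader. A second block hash in the view of [p] would
     therefore be issued as well, which is equivocation. *)
  rewrite -p_fresh => vT sT Tv; apply/eqP; apply: contraT => /eqP ne.
  case: L_honest_view.
  have Tp : 0 < tip_view T by rewrite Tv.
  have [idT sigT _ _] := valid_tipP vT Tp.
  exists (block_hash (tip_header T)), (block_hash (prop_block p)); split=> //.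
  by exists K; rewrite LE -Tv -idT; apply: sT; rewrite Tv -?Tv.
have cB0 : committable H genesis_payload Byz (net_sigs (cfg E K)) B0.
  have [logs' [invs' _ _]] := sound_execution H_inj E_exec kc.
  have leK : kc <= K by rewrite leq_maxl.
  apply: committable_mono (net_sigs_mono E_exec leK) _.
  exact: (inv_committed (invs' i i_correct) B0c).
rewrite p_fresh in Sbal.
(* [B'] is an ancestor of the directly committed [B0]. Either [p]'s block extends [B0] and hence
   [B'], or both it and [B'] are ancestors of [B0] and thus on one chain. *)
case: (committable_comparable H_inj Byz_le good just wB cS Scor Sbal uniqB cB0) => ex.
  by left; apply: extends_trans ex B0B'.
by case: (extends_comparable H_inj B0B' ex); [right|left].
Qed.
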